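(* Let $(M,g)$ be a two-dimensional Riemannian manifold, possibly with boundary $\partial M$. If $M$ admits a Killing field $X$ whose Hodge Laplacian $\Delta X$ is also Killing, then the sectional curvature of $M$ is constant.
   Context: A vector field $X$ is Killing if its flow acts by isometries, equivalently $g(\nabla_uX,v)+g(u,\nabla_vX)=0$ for all vector fields $u,v$. The Hodge Laplacian of a vector field is $\Delta X=((d\delta+\delta d)X^\flat)^\sharp$, where $\delta$ is the formal adjoint of the exterior derivative $d$.
   Formalization: M is assumed connected and the Killing field X not identically zero; otherwise the claim is false (X = 0 on any surface of nonconstant curvature, or rotation fields on two disjoint round spheres of different radii). *)

(* Defs.v *)
From mathcomp Require Import all_boot all_order all_algebra.
From mathcomp Require Import all_classical all_reals all_analysis.

Set Implicit Arguments.
Unset Strict Implicit.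
Unset Printing Implicit Defensive.

Import Order.TTheory GRing.Theory Num.Theory.
Import numFieldNormedType.Exports.

Local Open Scope classical_set_scope.
Local Open Scope ring_scope.

Definition half_plane (R : realType) : set (R * R) := [set x | 0 <= x.2].

Arguments half_plane : clear implicits.

Definition basis_vec (R : realType) (a : 'I_2) : R * R :=
  if a == 0 then (1, 0) else (0, 1).

Definition vec (R : realType) (x : R * R) : 'rV[R]_2 :=
  \row_a (if a == 0 then x.1 else x.2).

Fixpoint class_C (R : realType) (k : nat) (W : set (R * R)) (f : R * R -> R) :
    Prop :=
  (forall x, W x -> {for x, continuous f}) /\
  if k is k'.+1 then
    forall a : 'I_2,
      (forall x, W x -> derivable f x (basis_vec R a)) /\
      class_C k' W (fun x => 'D_(basis_vec R a) f x)
  else True.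

Definition smooth_open (R : realType) (W : set (R * R)) (f : R * R -> R) : Prop :=
  forall k, class_C k W f.

(* Smoothness on a set that need not be open in the plane: local existence of
   smooth extensions. *)
Definition smooth_on (R : realType) (A : set (R * R)) (f : R * R -> R) : Prop :=
  forall x, A x -> exists W : set (R * R), exists F : R * R -> R,
    [/\ open W, W x, smooth_open W F & forall y, (A `&` W) y -> F y = f y].

(* Coordinate partial derivative, taken along h > 0.  If f is smooth on a
   relatively open subset A of the half-plane and A x, then x + h e_a is in A
   for all small h > 0, so this is the partial derivative at x of any smooth
   extension of f; in particular it is meaningful on the boundary line. *)
Definition partial (R : realType) (a : 'I_2) (f : R * R -> R) (x : R * R) : R :=
  lim ((h^-1 * (f (x + h *: basis_vec R a) - f x)) @[h --> (0 : R)^'+]).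

(* Row b, column a: the derivative of the a-th component along the b-th
   coordinate. *)
Definition jacobian (R : realType) (tau : R * R -> R * R) (x : R * R) :
    'M[R]_2 :=
  \matrix_(b, a) partial b (fun y => vec (tau y) 0 a) x.

Record surface (R : realType) := Surface {
  carrier :> topologicalType;
  surface_hausdorff : hausdorff_space carrier;
  surface_second_countable : @second_countable carrier;
  chart : Type;
  chart_dom : chart -> set carrier;
  chart_map : chart -> carrier -> R * R;
  chart_inv : chart -> R * R -> carrier;
  chart_dom_open : forall i, open (chart_dom i);
  chart_dom_cover : forall p, exists i, chart_dom i p;
  chart_image_open : forall i, exists2 W : set (R * R), open W &
    chart_map i @` chart_dom i = W `&` half_plane R;
  chart_mapK : forall i p, chart_dom i p -> chart_inv i (chart_map i p) = p;
  chart_map_continuous : forall i,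
    {within chart_dom i, continuous (chart_map i)};
  chart_inv_continuous : forall i,
    {within chart_map i @` chart_dom i, continuous (chart_inv i)};
  transition_smooth : forall i j (a : 'I_2),
    smooth_on (chart_map i @` (chart_dom i `&` chart_dom j))
      (fun x => vec (chart_map j (chart_inv i x)) 0 a)
}.

Section Tensors.
Context {R : realType} (M : surface R).

Definition chart_image (i : chart M) : set (R * R) := chart_map i @` chart_dom i.

Definition overlap (i j : chart M) : set (R * R) :=
  chart_map i @` (chart_dom i `&` chart_dom j).

Definition transition (i j : chart M) (x : R * R) : R * R :=
  chart_map j (chart_inv i x).

Definition smooth_function (f : M -> R) : Prop :=
  forall i, smooth_on (chart_image i) (f \o chart_inv i).

(* Tensor fields are given by their components in every chart, related by the
   tensorial transformation laws.  Only the values on [chart_image i] are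
   meaningful. *)
Record vector_field := VectorField {
  vf_comp :> chart M -> R * R -> 'rV[R]_2;
  vf_smooth : forall i a, smooth_on (chart_image i) (fun x => vf_comp i x 0 a);
  vf_transform : forall i j x, overlap i j x ->
    vf_comp j (transition i j x) = vf_comp i x *m jacobian (transition i j) x
}.

Record one_form := OneForm {
  of_comp :> chart M -> R * R -> 'rV[R]_2;
  of_smooth : forall i a, smooth_on (chart_image i) (fun x => of_comp i x 0 a);
  of_transform : forall i j x, overlap i j x ->
    of_comp i x = of_comp j (transition i j x) *m (jacobian (transition i j) x)^T
}.

Definition vf_nonzero (X : vector_field) : Prop :=
  exists i, exists2 x, chart_image i x & X i x != 0.

End Tensors.

Record riemannian_surface (R : realType) := RiemannianSurface {
  surf :> surface R;
  metric : chart surf -> R * R -> 'M[R]_2;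
  metric_smooth : forall i a b,
    smooth_on (chart_image i) (fun x => metric i x a b);
  metric_sym : forall i x, chart_image i x -> (metric i x)^T = metric i x;
  metric_pos : forall i x (u : 'rV[R]_2), chart_image i x -> u != 0 ->
    0 < (u *m metric i x *m u^T) 0 0;
  metric_transform : forall i j x, overlap i j x ->
    metric i x = jacobian (transition i j) x *m metric j (transition i j x)
                   *m (jacobian (transition i j) x)^T
}.

Section Riemannian.
Context {R : realType} (M : riemannian_surface R).

Implicit Types (i : chart M) (x : R * R) (a b c d : 'I_2) (u v w : 'rV[R]_2).

Definition inner i x u v : R := (u *m metric i x *m v^T) 0 0.

(* Gamma^c_{ab} *)
Definition christoffel i a b c x : R :=
  2^-1 * \sum_(d < 2) invmx (metric i x) c d *
    (partial a (fun y => metric i y b d) x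
     + partial b (fun y => metric i y a d) x
     - partial d (fun y => metric i y a b) x).

(* nabla_u X at x, for a tangent vector u at x *)
Definition nabla i x u (X : vector_field M) : 'rV[R]_2 :=
  \row_c \sum_(a < 2) u 0 a *
    (partial a (fun y => X i y 0 c) x
     + \sum_(b < 2) christoffel i a b c x * X i x 0 b).

Definition killing (X : vector_field M) : Prop :=
  forall i x, chart_image i x -> forall u v,
    inner i x (nabla i x u X) v + inner i x u (nabla i x v X) = 0.

(* The e_d-component of R(e_a, e_b) e_c, with
   R(u, v) w = nabla_u nabla_v w - nabla_v nabla_u w - nabla_[u, v] w. *)
Definition riemann i x a b c d : R :=
  partial a (christoffel i b c d) x - partial b (christoffel i a c d) x
  + \sum_(e < 2) (christoffel i a e d x * christoffel i b c e x
                  - christoffel i b e d x * christoffel i a c e x).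

Definition curvature i x u v w : 'rV[R]_2 :=
  \row_d \sum_(a < 2) \sum_(b < 2) \sum_(c < 2)
    u 0 a * v 0 b * w 0 c * riemann i x a b c d.

Definition sectional_curvature i x u v : R :=
  inner i x (curvature i x u v v) u
  / (inner i x u u * inner i x v v - inner i x u v ^+ 2).

Definition constant_sectional_curvature : Prop :=
  exists kappa : R, forall i x, chart_image i x -> forall u v,
    row_free (col_mx u v) -> sectional_curvature i x u v = kappa.

Definition flat (X : vector_field M) i x : 'rV[R]_2 := X i x *m metric i x.

Definition sharp i x (alpha : 'rV[R]_2) : 'rV[R]_2 :=
  alpha *m invmx (metric i x).

Definition grad_comp (f : R * R -> R) x : 'rV[R]_2 := \row_a partial a f x.

(* The 2-form (d alpha) = curl_comp alpha * dx^0 /\ dx^1. *)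
Definition curl_comp (alpha : R * R -> 'rV[R]_2) x : R :=
  partial 0 (fun y => alpha y 0 1) x - partial 1 (fun y => alpha y 0 0) x.

Definition inner_1forms i x (alpha beta : 'rV[R]_2) : R :=
  (alpha *m invmx (metric i x) *m beta^T) 0 0.

(* Inner product of p dx^0 /\ dx^1 and q dx^0 /\ dx^1, for which
   e^0 /\ e^1 has norm one when (e^0, e^1) is an orthonormal coframe. *)
Definition inner_2forms i x (p q : R) : R := p * q / \det (metric i x).

(* Integration over the interior of the coordinate domain against the
   Riemannian volume element. *)
Definition chart_integral i (F : R * R -> R) : R :=
  \int[(lebesgue_measure \x lebesgue_measure)%E]_(x in (chart_image i)°)
    (F x * Num.sqrt (\det (metric i x))).

(* Smooth functions compactly supported in the interior of a coordinate
   domain. *)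
Definition test_function i (phi : R * R -> R) : Prop :=
  smooth_open setT phi /\
  exists2 C : set (R * R), compact C &
    C `<=` (chart_image i)° /\ forall x, ~ C x -> phi x = 0.

(* The defining property of the formal adjoint of d.  By partitions of unity it
   is enough to test against forms with compact support in the interior of one
   coordinate domain. *)
Definition is_codiff_1form (alpha : chart M -> R * R -> 'rV[R]_2) (f : M -> R) :
    Prop :=
  forall i (phi : R * R -> R), test_function i phi ->
    chart_integral i (fun x => inner_1forms i x (grad_comp phi x) (alpha i x))
    = chart_integral i (fun x => phi x * f (chart_inv i x)).

Definition is_codiff_2form (omega : chart M -> R * R -> R) (theta : one_form M) :
    Prop :=
  forall i (eta : R * R -> 'rV[R]_2),
    (forall a, test_function i (fun x => eta x 0 a)) ->
    chart_integral i (fun x => inner_2forms i x (curl_comp eta x) (omega i x))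
    = chart_integral i (fun x => inner_1forms i x (eta x) (theta i x)).

(* LX = ((d delta + delta d) X^flat)^sharp, where f = delta X^flat and
   theta = delta d X^flat; these are uniquely determined by X. *)
Definition is_hodge_laplacian (X LX : vector_field M) : Prop :=
  exists (f : M -> R) (theta : one_form M),
    [/\ smooth_function f,
        is_codiff_1form (flat X) f,
        is_codiff_2form (fun i => curl_comp (flat X i)) theta &
        forall i x, chart_image i x ->
          LX i x = sharp i x (grad_comp (f \o chart_inv i) x + theta i x)].

End Riemannian.

(* Main.v *)
Require Import Defs.
From mathcomp Require Import all_boot all_order all_algebra.
From mathcomp Require Import all_classical all_reals all_analysis.
From mathcomp Require Import measurable_realfun.
From mathcomp Require Import ring lra.

(* In a chart write alpha = X^flat, d alpha = w dx^0 /\ dx^1, s = sqrt (det g)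
   and rho = w / s.  The Killing equation says
     d_a alpha_b = Gamma^c_ab alpha_c + (w / 2) eps_ab,
   and commuting second derivatives gives d_b rho = (2 / s) R_01b^c alpha_c.
   Hence delta alpha = 0 and (delta d alpha)^sharp = (d_1 rho, - d_0 rho) / s, so
   the antisymmetry of R_01bc yields Delta X = 2 K X.  If K X is Killing as well,
   then d_a K alpha_b + d_b K alpha_a = 0, so dK = 0 wherever X <> 0.  The
   equations above are also a closed linear system for (alpha, w): by Gronwall's
   lemma along axis-parallel paths and connectedness, X cannot vanish on a
   nonempty open set, and dK = 0 everywhere by continuity.  The values of K in two
   charts agree because X and 2 K X both transform as vector fields, so the
   tensoriality of the curvature is not needed.
   The codifferential is given weakly; testing against smooth bump functions
   turns its defining identities into pointwise ones in the interior of a chart,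
   and continuity extends them to the boundary. *)

Set Implicit Arguments.
Unset Strict Implicit.
Unset Printing Implicit Defensive.

Import Order.TTheory GRing.Theory Num.Theory.
Import numFieldNormedType.Exports.

Local Open Scope classical_set_scope.
Local Open Scope ring_scope.

(** * Smooth functions and partial derivatives *)

Section ClassC.
Context {R : realType}.
Implicit Types (f g : R * R -> R) (V W A : set (R * R)) (x : R * R) (k : nat).

(** The formula for the Laplacian is the planar case of Delta X = 2 Ric(X), which holds for every
    Killing field; in dimension two Ric = K g. The system for (alpha, w) is the prolongation of the
    Killing equation: that equation fixes only the symmetric part of the derivative of alpha, and
    adjoining the curl closes the system. This is why the energy used for unique continuation
    contains w as well as alpha. The boundary shapes the rest. [partial] is a one-sided limit, and
    the codifferential is tested only in the interior of a chart, so the Laplacian and the Gronwall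
    estimates are handled first at points with positive second coordinate and then carried to the
    boundary line, where local smooth extensions supply continuity. No orientation is fixed. The
    sign of rho depends on the chart, so rho never leaves a single chart; K does not see that
    sign. *)

Lemma nbhs_open (T : topologicalType) (x : T) (P : set T) : nbhs x P ->
  exists B : set T, [/\ open B, B x & B `<=` P].
Proof.
move=> nP; exists P°; split; [exact: open_interior|exact: nP|].
exact: interior_subset.
Qed.

Lemma near_eq_on_open W f g x : open W -> W x -> (forall y, W y -> f y = g y) ->
  \forall y \near x, f y = g y.
Proof.
by move=> oW Wx fg; apply: filterS fg _; exact: open_nbhs_nbhs.
Qed.

Lemma near_eq_continuous f g x : (\forall y \near x, f y = g y) ->
  {for x, continuous f} -> {for x, continuous g}.
Proof.
move=> fg; rewrite /prop_for /continuous_at -(nbhs_singleton fg).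
by apply: cvg_trans; apply: near_eq_cvg; apply: filterS fg => y ->.
Qed.

Lemma class_C_continuous k W f x : class_C k W f -> W x -> {for x, continuous f}.
Proof. by case: k => [|k] [cf _]; exact: cf. Qed.

Lemma class_CW k W f : class_C k.+1 W f -> class_C k W f.
Proof.
elim: k f => [|k IH] f [cf df]; split => //.
by move=> a; have [d c] := df a; split => //; exact: IH.
Qed.

Lemma class_C_subset k V W f : V `<=` W -> class_C k W f -> class_C k V f.
Proof.
move=> VW; elim: k f => [|k IH] f [cf df]; split=> //; try by move=> x /VW; exact: cf.
by move=> a; have [d c] := df a; split; [move=> x /VW; exact: d|exact: IH].
Qed.

Lemma class_C_eq k W f g : open W -> (forall x, W x -> f x = g x) ->
  class_C k W f -> class_C k W g.
Proof.
move=> oW; elim: k f g => [|k IH] f g fg [cf df]; split=> //.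
- by move=> x Wx; apply: near_eq_continuous (cf _ Wx); exact: near_eq_on_open fg.
- by move=> x Wx; apply: near_eq_continuous (cf _ Wx); exact: near_eq_on_open fg.
- move=> a; have [d c] := df a; split.
    move=> x Wx; apply: near_eq_derivable (d _ Wx).
    exact: near_eq_on_open fg.
  apply: IH c => x Wx; apply: near_eq_derive.
  exact: near_eq_on_open fg.
Qed.

(** Serves to glue the local extensions provided by [smooth_on]. *)
Lemma class_C_local k W f :
  (forall x, W x -> exists V, [/\ open V, V x & class_C k V f]) ->
  class_C k W f.
Proof.
elim: k f => [|k IH] f loc; split=> //.
- by move=> x /loc[V [oV Vx]]; move=> /class_C_continuous; exact.
- by move=> x /loc[V [oV Vx]]; move=> /class_C_continuous; exact.
- move=> a; split.
    by move=> x /loc[V [oV Vx]] [_ /(_ a)[+ _]]; exact.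
  apply: IH => x /loc[V [oV Vx]] [_ /(_ a)[_ ?]]; by exists V.
Qed.

Lemma class_C_cst k W (c : R) : class_C k W (fun=> c).
Proof.
elim: k c => [|k IH] c; split=> //; try by move=> x _; exact: cvg_cst.
move=> a; split; first by move=> x _; exact: derivable_cst.
have -> : (fun x => 'D_(basis_vec R a) (fun=> c) x) = fun=> 0.
  by apply/funext => x; exact: derive_cst.
exact: IH.
Qed.

Lemma class_CD k W f g : open W ->
  class_C k W f -> class_C k W g -> class_C k W (fun x => f x + g x).
Proof.
move=> oW; elim: k f g => [|k IH] f g [cf df] [cg dg]; split=> //;
  try by move=> x Wx; apply: continuousD; [exact: cf|exact: cg].
move=> a; have [df1 cf1] := df a; have [dg1 cg1] := dg a; split.
  by move=> x Wx; apply: derivableD; [exact: df1|exact: dg1].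
apply: class_C_eq (IH _ _ cf1 cg1) => // x Wx.
by rewrite -deriveD //; [exact: df1|exact: dg1].
Qed.

Lemma class_CM k W f g : open W ->
  class_C k W f -> class_C k W g -> class_C k W (fun x => f x * g x).
Proof.
move=> oW; elim: k f g => [|k IH] f g Cf Cg.
  by split=> // x Wx; apply: continuousM;
    [exact: class_C_continuous Cf _|exact: class_C_continuous Cg _].
split.
  by move=> x Wx; apply: continuousM;
    [exact: class_C_continuous Cf _|exact: class_C_continuous Cg _].
have [Cf' Cg'] := (class_CW Cf, class_CW Cg).
case: Cf => [cf df]; case: Cg => [cg dg].
move=> a; have [df1 cf1] := df a; have [dg1 cg1] := dg a; split.
  by move=> x Wx; apply: derivableM; [exact: df1|exact: dg1].
apply: class_C_eq (class_CD oW (IH _ _ Cf' cg1) (IH _ _ Cg' cf1)) => // x Wx.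
by rewrite -[LHS]deriveM //; [exact: df1|exact: dg1].
Qed.

Lemma class_CV k W f : open W -> (forall x, W x -> f x != 0) ->
  class_C k W f -> class_C k W (fun x => (f x)^-1).
Proof.
move=> oW f0; elim: k => [|k IH] Cf.
  by split=> // x Wx; apply: cvgV; [exact: f0|exact: class_C_continuous Cf _].
have Cf' := class_CW Cf; case: Cf => [cf df]; split.
  by move=> x Wx; apply: cvgV; [exact: f0|exact: cf].
move=> a; have [df1 cf1] := df a; split.
  by move=> x Wx; apply: derivableV; [exact: f0|exact: df1].
have C1 := class_CM oW (IH Cf') (IH Cf').
apply: class_C_eq (class_CM oW (class_CM oW (class_C_cst k W (-1)) C1) cf1) => // x Wx.
rewrite deriveV; [|exact: f0|exact: df1].
by rewrite /GRing.scale /= expr2 invfM mulN1r.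
Qed.

(** A single directional derivative does not give differentiability at x, so the chain rule is
    applied to the restriction of f to the line through x in the direction v. *)
Lemma is_derive_sqrt_comp f x (v : R * R) : 0 < f x -> derivable f x v ->
  is_derive x v (fun y => Num.sqrt (f y)) ((2 * Num.sqrt (f x))^-1 * 'D_v f x).
Proof.
move=> f0 df.
pose p h := f (h *: v + x).
have p0 : p 0 = f x by rewrite /p scale0r add0r.
have dp : derivable p 0 1 by exact: ((derivable1P f x v).1 df).
have [ds es] : is_derive (p 0) 1 (@Num.sqrt R) (2 * Num.sqrt (p 0))^-1.
  by apply: is_derive1_sqrt; rewrite p0.
have dsp : derivable (@Num.sqrt R \o p) 0 1.
  have dp' := (derivable1_diffP p 0).1 dp.
  have ds' := (derivable1_diffP (@Num.sqrt R) (p 0)).1 ds.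
  exact: (derivable1_diffP (@Num.sqrt R \o p) 0).2 (differentiable_comp dp' ds').
have E g : 'D_v g x = 'D_1 (fun h : R => g (h *: v + x)) 0.
  rewrite /derive; apply: (congr1 (fun k : R -> R => lim (k @ 0^'))); apply/funext => h /=.
  by rewrite addr0 scale0r add0r [_%:A]mulr1.
split; first exact: ((derivable1P (fun y => Num.sqrt (f y)) x v).2 dsp).
rewrite !E -!derive1E [LHS](derive1_comp dp ds) !derive1E es.
by rewrite p0.
Qed.

Lemma class_C_sqrt k W f : open W -> (forall x, W x -> 0 < f x) ->
  class_C k W f -> class_C k W (fun x => Num.sqrt (f x)).
Proof.
move=> oW f0; elim: k => [|k IH] Cf.
  split=> // x Wx; apply: continuous_comp; last exact: sqrt_continuous.
  exact: class_C_continuous Cf _.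
have Cf' := class_CW Cf; case: Cf => [cf df]; split.
  move=> x Wx; apply: continuous_comp; last exact: sqrt_continuous.
  exact: cf.
move=> a; have [df1 cf1] := df a; split.
  by move=> x Wx; have [] := is_derive_sqrt_comp (f0 _ Wx) (df1 _ Wx).
have n0 x : W x -> 2 * Num.sqrt (f x) != 0.
  by move=> Wx; rewrite mulf_neq0 // gt_eqF // sqrtr_gt0; exact: f0.
have C1 := class_CV oW n0 (class_CM oW (class_C_cst k W 2) (IH Cf')).
apply: class_C_eq (class_CM oW C1 cf1) => // x Wx.
by have [_ ->] := is_derive_sqrt_comp (f0 _ Wx) (df1 _ Wx).
Qed.

End ClassC.

(** * Smoothness up to the boundary line and one-sided partial derivatives *)

Section SmoothOn.
Context {R : realType}.
Implicit Types (f g F : R * R -> R) (U V W A : set (R * R)) (x : R * R) (a b : 'I_2).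

Lemma smooth_open_derive W f a : smooth_open W f ->
  smooth_open W (fun x => 'D_(basis_vec R a) f x).
Proof. by move=> sf k; have [_ /(_ a)[]] := sf k.+1. Qed.

Lemma smooth_open_derivable W f a x : smooth_open W f -> W x ->
  derivable f x (basis_vec R a).
Proof. by move=> sf Wx; have [_ /(_ a)[+ _]] := sf 1%N; exact. Qed.

Lemma smooth_open_continuous W f x : smooth_open W f -> W x -> {for x, continuous f}.
Proof. by move=> sf Wx; exact: class_C_continuous (sf 0%N) Wx. Qed.

Lemma smooth_open_subset V W f : V `<=` W -> smooth_open W f -> smooth_open V f.
Proof. by move=> VW sf k; exact: class_C_subset (sf k). Qed.

Lemma smooth_on_open A U f : smooth_on A f -> open U -> U `<=` A -> smooth_open U f.
Proof.
move=> sf oU UA k; apply: class_C_local => x Ux.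
have [W [F [oW Wx sF Ff]]] := sf x (UA _ Ux).
exists (U `&` W); split; [exact: openI|by []|].
have oUW := openI oU oW.
apply: (@class_C_eq _ _ _ F) => //.
  by move=> y [Uy Wy]; apply: Ff; split=> //; exact: UA.
by apply: class_C_subset (sF k) => y [].
Qed.

Lemma smooth_on_subset A B f : A `<=` B -> smooth_on B f -> smooth_on A f.
Proof.
move=> AB sf x Ax; have [W [F [oW Wx sF Ff]]] := sf x (AB _ Ax).
by exists W, F; split=> // y [Ay Wy]; apply: Ff; split=> //; exact: AB.
Qed.

Lemma smooth_on_eq A f g : (forall x, A x -> f x = g x) -> smooth_on A f ->
  smooth_on A g.
Proof.
move=> fg sf x Ax; have [W [F [oW Wx sF Ff]]] := sf x Ax.
by exists W, F; split=> // y AWy; rewrite Ff //; apply: fg; case: AWy.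
Qed.

Lemma smooth_on_cst A (c : R) : smooth_on A (fun=> c).
Proof.
move=> x Ax; exists setT, (fun=> c); split => //; first exact: openT.
by move=> k; exact: class_C_cst.
Qed.

Lemma smooth_onD A f g : smooth_on A f -> smooth_on A g ->
  smooth_on A (fun x => f x + g x).
Proof.
move=> sf sg x Ax; have [W [F [oW Wx sF Ff]]] := sf x Ax.
have [V [G [oV Vx sG Gg]]] := sg x Ax.
exists (W `&` V), (fun x => F x + G x); split=> //; first exact: openI.
  move=> k; apply: class_CD; first exact: openI.
    by apply: class_C_subset (sF k) => y [].
  by apply: class_C_subset (sG k) => y [].
by move=> y [Ay [Wy Vy]]; rewrite Ff // Gg.
Qed.

Lemma smooth_onM A f g : smooth_on A f -> smooth_on A g ->
  smooth_on A (fun x => f x * g x).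
Proof.
move=> sf sg x Ax; have [W [F [oW Wx sF Ff]]] := sf x Ax.
have [V [G [oV Vx sG Gg]]] := sg x Ax.
exists (W `&` V), (fun x => F x * G x); split=> //; first exact: openI.
  move=> k; apply: class_CM; first exact: openI.
    by apply: class_C_subset (sF k) => y [].
  by apply: class_C_subset (sG k) => y [].
by move=> y [Ay [Wy Vy]]; rewrite Ff // Gg.
Qed.

Lemma smooth_onN A f : smooth_on A f -> smooth_on A (fun x => - f x).
Proof.
move=> sf; apply: (smooth_on_eq _ (smooth_onM (smooth_on_cst (A := A) (-1)) sf)) => x _.
by rewrite mulN1r.
Qed.

Lemma smooth_onB A f g : smooth_on A f -> smooth_on A g ->
  smooth_on A (fun x => f x - g x).
Proof. by move=> sf sg; apply: smooth_onD => //; exact: smooth_onN. Qed.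

Lemma smooth_on_sum A (F : 'I_2 -> R * R -> R) : (forall i, smooth_on A (F i)) ->
  smooth_on A (fun x => \sum_(i < 2) F i x).
Proof.
move=> sF; apply: (smooth_on_eq _ (smooth_onD (sF ord0) (sF (lift ord0 ord0)))) => x _.
by rewrite !big_ord_recl big_ord0 addr0.
Qed.

Lemma smooth_onV A f : (forall x, A x -> f x != 0) -> smooth_on A f ->
  smooth_on A (fun x => (f x)^-1).
Proof.
move=> f0 sf x Ax; have [W [F [oW Wx sF Ff]]] := sf x Ax.
have cF : {for x, continuous F} by exact: smooth_open_continuous sF Wx.
have : \forall y \near x, F y != 0.
  by apply: (cF [set z | z != 0]); apply: open_nbhs_nbhs; split;
    [exact: open_neq|rewrite /= Ff //; exact: f0].
move=> nF; have /nbhs_open[V [oV Vx VF]] := nF.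
exists (W `&` V), (fun x => (F x)^-1); split=> //; first exact: openI.
  move=> k; apply: class_CV; first exact: openI.
    by move=> y [_ /VF].
  by apply: class_C_subset (sF k) => y [].
by move=> y [Ay [Wy Vy]]; rewrite Ff.
Qed.

Lemma smooth_on_sqrt A f : (forall x, A x -> 0 < f x) -> smooth_on A f ->
  smooth_on A (fun x => Num.sqrt (f x)).
Proof.
move=> f0 sf x Ax; have [W [F [oW Wx sF Ff]]] := sf x Ax.
have cF : {for x, continuous F} by exact: smooth_open_continuous sF Wx.
have : \forall y \near x, 0 < F y.
  by apply: (cF [set z | 0 < z]); apply: open_nbhs_nbhs; split;
    [exact: open_gt|rewrite /= Ff //; exact: f0].
move=> nF; have /nbhs_open[V [oV Vx VF]] := nF.
exists (W `&` V), (fun x => Num.sqrt (F x)); split=> //; first exact: openI.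
  move=> k; apply: class_C_sqrt; first exact: openI.
    by move=> y [_ /VF].
  by apply: class_C_subset (sF k) => y [].
by move=> y [Ay [Wy Vy]]; rewrite Ff.
Qed.

Lemma partial_derive a f x : derivable f x (basis_vec R a) ->
  partial a f x = 'D_(basis_vec R a) f x.
Proof.
move=> df; rewrite /derive /partial cvg_at_rightE //.
apply: (congr1 (fun k : R -> R => lim (k @ 0^'+))).
by apply/funext => h /=; rewrite (addrC x).
Qed.

Lemma cvg_line x (v : R * R) : (fun h : R => x + h *: v) @ (0 : R) --> x.
Proof.
suff : (fun h : R => x + h *: v) @ (0 : R) --> x + (0 : R) *: v.
  by rewrite scale0r addr0.
apply: cvgD; first exact: cvg_cst.
by apply: cvgZ; [exact: cvg_id|exact: cvg_cst].
Qed.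

Lemma near_line_right W x (v : R * R) : open W -> W x ->
  \forall h \near (0 : R)^'+, W (x + h *: v).
Proof.
move=> oW Wx; have nW : nbhs x W by exact: open_nbhs_nbhs.
by have := cvg_at_right_filter (@cvg_line x v); apply.
Qed.

Definition half_open A := exists2 W, open W & A = W `&` half_plane R.

Lemma half_open_near A x a : half_open A -> A x ->
  \forall h \near (0 : R)^'+, A (x + h *: basis_vec R a).
Proof.
move=> [W oW ->] [Wx Hx]; near=> h; split.
  near: h; exact: near_line_right.
rewrite /half_plane /= /basis_vec.
by case: ifP => _ /=; rewrite ?[_ *: _]mulr0 ?addr0 // [_ *: _]mulr1 addr_ge0.
Unshelve. all: by end_near. Qed.

(** For small h > 0 the quotients in [partial] see only points of A inside V, since neither basis
    vector leads out of the half-plane. A smooth extension may therefore replace f, even at a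
    boundary point. *)
Lemma partial_ext A V f F x a : half_open A -> A x -> open V -> V x ->
  (forall y, (A `&` V) y -> F y = f y) -> partial a f x = partial a F x.
Proof.
move=> hA Ax oV Vx Ff; rewrite /partial; congr lim.
have E : \forall h \near (0 : R)^'+,
   h^-1 * (f (x + h *: basis_vec R a) - f x) =
   h^-1 * (F (x + h *: basis_vec R a) - F x).
  near=> h; rewrite !Ff //; split=> //; first by near: h; exact: half_open_near.
  near: h; exact: near_line_right.
rewrite eqEsubset; split; apply: near_eq_cvg => //.
by apply: filterS E => h ->.
Unshelve. all: by end_near. Qed.

Lemma partial_eq A f g x a : half_open A -> A x -> (forall y, A y -> f y = g y) ->
  partial a f x = partial a g x.
Proof.
move=> hA Ax fg; apply: (partial_ext a hA Ax openT) => // y [Ay _].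
by rewrite fg.
Qed.

(** The rules for [partial] are reduced through such an extension to those for directional
    derivatives on open sets. The last clause holds at all points of A near x, so it also yields
    smoothness of [partial a f]. *)
Lemma smooth_on_ext A f x : half_open A -> smooth_on A f -> A x ->
  exists W, exists F, [/\ open W, W x, smooth_open W F,
    forall y, (A `&` W) y -> F y = f y &
    forall y a, (A `&` W) y -> 'D_(basis_vec R a) F y = partial a f y].
Proof.
move=> hA sf Ax; have [W [F [oW Wx sF Ff]]] := sf x Ax.
exists W, F; split => // y a [Ay Wy].
rewrite (partial_ext a hA Ay oW Wy Ff) partial_derive //.
exact: smooth_open_derivable sF Wy.
Qed.

Lemma smooth_on_partial A f a : half_open A -> smooth_on A f ->
  smooth_on A (partial a f).
Proof.
move=> hA sf x Ax; have [W [F [oW Wx sF Ff DFf]]] := smooth_on_ext hA sf Ax.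
exists W, (fun x => 'D_(basis_vec R a) F x); split => //.
  exact: smooth_open_derive.
by move=> y AWy; exact: DFf.
Qed.

Lemma partial_cst a (c : R) x : partial a (fun=> c) x = 0.
Proof. by rewrite partial_derive; [exact: derive_cst|exact: derivable_cst]. Qed.

Lemma partialD A f g a x : half_open A -> smooth_on A f -> smooth_on A g -> A x ->
  partial a (fun y => f y + g y) x = partial a f x + partial a g x.
Proof.
move=> hA sf sg Ax; have [W [F [oW Wx sF Ff DFf]]] := smooth_on_ext hA sf Ax.
have [V [G [oV Vx sG Gg DGg]]] := smooth_on_ext hA sg Ax.
rewrite -DFf // -DGg // -deriveD; [|exact: smooth_open_derivable sF Wx
  |exact: smooth_open_derivable sG Vx].
rewrite -partial_derive; last by apply: derivableD;
  [exact: smooth_open_derivable sF Wx |exact: smooth_open_derivable sG Vx].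
apply: (partial_ext a hA Ax (openI oW oV)) => // y [Ay [Wy Vy]].
by rewrite /GRing.add /= Ff // Gg.
Qed.

Lemma partialM A f g a x : half_open A -> smooth_on A f -> smooth_on A g -> A x ->
  partial a (fun y => f y * g y) x = partial a f x * g x + f x * partial a g x.
Proof.
move=> hA sf sg Ax; have [W [F [oW Wx sF Ff DFf]]] := smooth_on_ext hA sf Ax.
have [V [G [oV Vx sG Gg DGg]]] := smooth_on_ext hA sg Ax.
transitivity ('D_(basis_vec R a) (F * G) x).
  rewrite -partial_derive; last by apply: derivableM;
    [exact: smooth_open_derivable sF Wx |exact: smooth_open_derivable sG Vx].
  apply: (partial_ext a hA Ax (openI oW oV)) => // y [Ay [Wy Vy]].
  by rewrite /GRing.mul /= Ff // Gg.
rewrite deriveM; [|exact: smooth_open_derivable sF Wx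
  |exact: smooth_open_derivable sG Vx].
by rewrite DFf // DGg // Ff // Gg // addrC /GRing.scale /= (mulrC (g x)).
Qed.

Lemma partialN A f a x : half_open A -> smooth_on A f -> A x ->
  partial a (fun y => - f y) x = - partial a f x.
Proof.
move=> hA sf Ax.
rewrite (partial_eq (g := fun y => (-1) * f y) a hA Ax); last first.
  by move=> y _; rewrite mulN1r.
by rewrite (partialM a hA (smooth_on_cst (A := A) (-1)) sf Ax) partial_cst mul0r add0r mulN1r.
Qed.

Lemma partialB A f g a x : half_open A -> smooth_on A f -> smooth_on A g -> A x ->
  partial a (fun y => f y - g y) x = partial a f x - partial a g x.
Proof.
by move=> hA sf sg Ax; rewrite (partialD a hA sf (smooth_onN sg) Ax) (partialN a hA sg Ax).
Qed.

End SmoothOn.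

(** * Second derivatives and Gronwall estimates *)

Section Slices.
Context {R : realType}.
Implicit Types (f g F : R * R -> R) (U V W A : set (R * R)) (x : R * R) (a b : 'I_2).

Definition axis a (t s : R) : R * R := if a == 0 then (t, s) else (s, t).

Definition other a : 'I_2 := if a == 0 then 1 else 0.

Lemma axis_other a t s : axis (other a) s t = axis a t s.
Proof. by rewrite /axis /other; case: (a == 0). Qed.

Lemma is_derive_axis F a t s (d : R) :
  is_derive (axis a t s) (basis_vec R a) F d ->
  is_derive t 1 (fun t => F (axis a t s)) d.
Proof.
have E : (fun h => h^-1 *: (((fun t => F (axis a t s)) \o shift t) (h *: 1) -
            F (axis a t s))) =
         (fun h => h^-1 *: ((F \o shift (axis a t s)) (h *: basis_vec R a) -
            F (axis a t s))).
  apply/funext => h /=; congr (_ *: (F _ - _)).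
  rewrite /axis /basis_vec; case: ifP => _;
  by rewrite /GRing.add /= /GRing.scale /= /scale_pair /= /add_pair /=; congr (_, _);
    rewrite /GRing.scale /= ?mulr0 ?add0r.
by case=> df dF; split; [rewrite /derivable E|rewrite /derive E].
Qed.

Lemma smooth_open_is_derive W F a t s : smooth_open W F -> W (axis a t s) ->
  is_derive t 1 (fun t => F (axis a t s)) ('D_(basis_vec R a) F (axis a t s)).
Proof.
move=> sF Wx; apply: is_derive_axis; apply: derivableP.
exact: smooth_open_derivable sF Wx.
Qed.

Lemma continuous_is_derive (f df : R -> R) (u v : R) :
  (forall t, t \in `[u, v] -> is_derive t 1 f (df t)) -> {within `[u, v], continuous f}.
Proof.
by move=> fd; apply: derivable_within_continuous => t /fd[].
Qed.

(** The mean value theorem is applied twice: to the increment of F across the square, then to the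
    derivative so obtained. *)
Lemma mixed_difference W F a (u v h : R) : smooth_open W F -> 0 < h ->
  (forall s t, 0 <= s <= h -> 0 <= t <= h -> W (axis a (u + s) (v + t))) ->
  exists s, exists t, [/\ 0 <= s <= h, 0 <= t <= h &
    F (axis a (u + h) (v + h)) - F (axis a (u + h) v) - F (axis a u (v + h))
      + F (axis a u v)
    = h * h * 'D_(basis_vec R (other a)) (fun y => 'D_(basis_vec R a) F y)
        (axis a (u + s) (v + t))].
Proof.
move=> sF h0 Wr.
have Wr' s t : s \in `[u, u + h] -> t \in `[v, v + h] -> W (axis a s t).
  rewrite !in_itv /= => /andP[s1 s2] /andP[t1 t2].
  rewrite -(subrKC u s) -(subrKC v t).
  by apply: Wr; rewrite ?subr_ge0 ?s1 ?t1 /= lerBlDl.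
have hh : 0 <= h <= h by rewrite lexx ltW.
have uv (w : R) : w < w + h by rewrite ltrDl.
have inw (w : R) : w \in `[w, w + h] by rewrite in_itv /= lexx lerDl ltW.
have inwh (w : R) : w + h \in `[w, w + h] by rewrite in_itv /= lexx lerDl ltW.
pose p t := F (axis a t (v + h)) - F (axis a t v).
pose dp t := 'D_(basis_vec R a) F (axis a t (v + h)) - 'D_(basis_vec R a) F (axis a t v).
have pd t : t \in `[u, u + h] -> is_derive t 1 p (dp t).
  by move=> tu; apply: is_deriveB; apply: smooth_open_is_derive sF _; exact: Wr'.
have oc (w t : R) : t \in `]w, w + h[ -> t \in `[w, w + h].
  by apply: subset_itv_oo_cc.
have [s su ps] := MVT (uv u) (fun t ti => pd t (oc u t ti)) (continuous_is_derive pd).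
pose q t := 'D_(basis_vec R a) F (axis a s t).
pose dq t := 'D_(basis_vec R (other a)) (fun y => 'D_(basis_vec R a) F y) (axis a s t).
have qd t : t \in `[v, v + h] -> is_derive t 1 q (dq t).
  move=> tv; rewrite /q /dq.
  under eq_fun do rewrite -axis_other; rewrite -axis_other.
  apply: smooth_open_is_derive; first exact: smooth_open_derive sF.
  by rewrite axis_other; apply: Wr' => //; exact: oc.
have [t tv qt] := MVT (uv v) (fun t ti => qd t (oc v t ti)) (continuous_is_derive qd).
exists (s - u), (t - v); split.
- by move: su; rewrite in_itv /= => /andP[/ltW ? /ltW ?]; rewrite subr_ge0 lerBlDl; apply/andP.
- by move: tv; rewrite in_itv /= => /andP[/ltW ? /ltW ?]; rewrite subr_ge0 lerBlDl; apply/andP.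
rewrite !subrKC.
have -> : F (axis a (u + h) (v + h)) - F (axis a (u + h) v) - F (axis a u (v + h))
      + F (axis a u v) = p (u + h) - p u by rewrite /p; ring.
rewrite ps /dp -/(q (v + h)) -/(q v) qt /dq; ring.
Qed.

Lemma nbhs_square (P : set (R * R)) x : nbhs x P ->
  exists2 h : R, 0 < h &
    forall s t, 0 <= s <= h -> 0 <= t <= h -> P (x.1 + s, x.2 + t).
Proof.
move=> /nbhs_ballP[r /= r0 rP]; exists (r / 2); first exact: divr_gt0.
move=> s t /andP[s0 sr] /andP[t0 tr]; apply: rP.
by split; rewrite /ball /= opprD addNKr normrN ger0_norm //; lra.
Qed.

(** The second difference over a square is symmetric in the two coordinates. Hence one mixed
    derivative at some point of an arbitrarily small square equals the other at some point of the
    same square, and continuity brings both points to x. *)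
Lemma derive_comm W F x : open W -> smooth_open W F -> W x ->
  'D_(basis_vec R 1) (fun y => 'D_(basis_vec R 0) F y) x =
  'D_(basis_vec R 0) (fun y => 'D_(basis_vec R 1) F y) x.
Proof.
move=> oW sF Wx.
set P := fun y : R * R => 'D_(basis_vec R 1) (fun y => 'D_(basis_vec R 0) F y) y.
set Q := fun y : R * R => 'D_(basis_vec R 0) (fun y => 'D_(basis_vec R 1) F y) y.
have cP : {for x, continuous P}.
  by apply: smooth_open_continuous Wx; do 2 apply: smooth_open_derive.
have cQ : {for x, continuous Q}.
  by apply: smooth_open_continuous Wx; do 2 apply: smooth_open_derive.
apply/eqP; rewrite -/(P x) -/(Q x) -subr_eq0 -normr_le0 leNgt; apply/negP => e0.
set e := `|P x - Q x| in e0.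
have e20 : 0 < e / 2 by rewrite divr_gt0.
have nP : nbhs x [set y | `|P x - P y| < e / 2].
  by move/cvgrPdist_lt : cP => /(_ _ e20).
have nQ : nbhs x [set y | `|Q x - Q y| < e / 2].
  by move/cvgrPdist_lt : cQ => /(_ _ e20).
have nW : nbhs x W by exact: open_nbhs_nbhs.
have [h h0 hW] := nbhs_square (filterI nW (filterI nP nQ)).
have [s [t [sh th E1]]] := mixed_difference (a := 0) (u := x.1) (v := x.2) sF h0
  (fun s t sh th => (hW s t sh th).1).
have [t' [s' [th' sh' E2]]] := mixed_difference (a := 1) (u := x.2) (v := x.1) sF h0
  (fun t s th sh => (hW s t sh th).1).
have [_ [pb _]] := hW _ _ sh th.
have [_ [_ qb]] := hW _ _ sh' th'.
have EE : P (x.1 + s, x.2 + t) = Q (x.1 + s', x.2 + t').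
  apply: (mulfI (x := h * h)); first by rewrite mulf_neq0 ?gt_eqF.
  transitivity (F (x.1 + h, x.2 + h) - F (x.1 + h, x.2)
    - F (x.1, x.2 + h) + F (x.1, x.2)); first by symmetry; exact: E1.
  by apply: etrans E2; rewrite /axis /=; ring.
suff : `|P x - Q x| < e by rewrite ltxx.
have tri (p p' q q' d : R) : p' = q' -> `|p - p'| < d / 2 -> `|q - q'| < d / 2 ->
    `|p - q| < d.
  move=> -> pd qd; rewrite (_ : p - q = (p - q') - (q - q')); last by ring.
  by apply: (le_lt_trans (ler_normB _ _)); rewrite [X in _ < X](splitr d) ltrD.
exact: tri EE pb qb.
Qed.

Lemma partial_comm A f x : half_open A -> smooth_on A f -> A x ->
  partial 1 (partial 0 f) x = partial 0 (partial 1 f) x.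
Proof.
move=> hA sf Ax; have [W [F [oW Wx sF Ff DFf]]] := smooth_on_ext hA sf Ax.
rewrite (partial_ext 1 hA Ax oW Wx (F := fun y => 'D_(basis_vec R 0) F y)); last first.
  by move=> y ?; exact: DFf.
rewrite (partial_ext 0 hA Ax oW Wx (F := fun y => 'D_(basis_vec R 1) F y)); last first.
  by move=> y ?; exact: DFf.
rewrite !partial_derive; first exact: derive_comm sF Wx.
  by apply: smooth_open_derivable Wx; exact: smooth_open_derive.
by apply: smooth_open_derivable Wx; exact: smooth_open_derive.
Qed.

(** The bound makes exp(- c t) f(t) nonincreasing and exp(c t) f(t) nondecreasing. A nonnegative f
    that vanishes at s therefore vanishes on its right by the first and on its left by the
    second. *)
Lemma gronwall_zero (f df : R -> R) (u v c s : R) :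
  (forall t, t \in `]u, v[ -> is_derive t 1 f (df t)) ->
  (forall t, t \in `]u, v[ -> 0 <= f t) ->
  (forall t, t \in `]u, v[ -> `|df t| <= c * f t) ->
  s \in `]u, v[ -> f s = 0 -> forall t, t \in `]u, v[ -> f t = 0.
Proof.
move=> fd f0 fb su fs t tu; apply/eqP; rewrite eq_le f0 // andbT.
have sub (p q r : R) : p \in `]u, v[ -> q \in `]u, v[ -> r \in `[p, q] -> r \in `]u, v[.
  rewrite !in_itv /= => /andP[p1 p2] /andP[q1 q2] /andP[r1 r2].
  by rewrite (lt_le_trans p1 r1) (le_lt_trans r2 q2).
pose g k r := expR (k * r) * f r.
pose dg k r := expR (k * r) * (df r + k * f r).
have gd k r : r \in `]u, v[ -> is_derive r 1 (g k) (dg k r).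
  move=> /fd fdr.
  have ed : is_derive r 1 (fun r => expR (k * r)) (k * expR (k * r)).
    have kd : is_derive r 1 (fun r => k * r) k.
      have := @is_deriveZ R R R id k r 1 1 (is_derive_id _ _).
      by rewrite [k *: (1 : R)]mulr1.
    have := @is_derive1_comp R (@expR R) (fun r => k * r) r (expR (k * r)) k
      (is_derive_expR _) kd.
    by rewrite mulrC.
  have fg := @is_deriveM _ _ _ _ _ _ _ _ ed fdr.
  apply: (is_derive_eq fg); rewrite /dg /GRing.scale /=; ring.
have [st|ts] := leP s t.
  have [r rst E] := MVT_segment st
    (fun r ri => gd (- c) r (sub s t r su tu (subset_itv_oo_cc ri)))
    (continuous_is_derive (fun r ri => gd (- c) r (sub s t r su tu ri))).
  have rI := sub s t r su tu rst.
  have := fb _ rI; rewrite ler_norml => /andP[_ dfr].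
  have dgr : dg (- c) r <= 0.
    by rewrite /dg mulr_ge0_le0 ?expR_ge0 // mulNr subr_le0.
  have : g (- c) t <= 0.
    move: E; rewrite {2}/g fs mulr0 subr0 => ->.
    by rewrite mulr_le0_ge0 // subr_ge0.
  by rewrite /g pmulr_rle0 // expR_gt0.
have [r rst E] := MVT_segment (ltW ts)
  (fun r ri => gd c r (sub t s r tu su (subset_itv_oo_cc ri)))
  (continuous_is_derive (fun r ri => gd c r (sub t s r tu su ri))).
have rI := sub t s r tu su rst.
have := fb _ rI; rewrite ler_norml => /andP[dfr _].
have dgr : 0 <= dg c r.
  by rewrite /dg mulr_ge0 ?expR_ge0 // -lerBlDr sub0r.
have : g c t <= 0.
  rewrite -oppr_ge0; move: E; rewrite {1}/g fs mulr0 sub0r => ->.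
  by rewrite mulr_ge0 // subr_ge0 ltW.
by rewrite /g pmulr_rle0 // expR_gt0.
Qed.

Definition rect (u1 v1 u2 v2 : R) : set (R * R) :=
  [set x | (x.1 \in `]u1, v1[) /\ (x.2 \in `]u2, v2[)].

Lemma gronwall_rect u1 v1 u2 v2 f (c : R) q :
  smooth_open (rect u1 v1 u2 v2) f ->
  (forall x, rect u1 v1 u2 v2 x -> 0 <= f x) ->
  (forall a x, rect u1 v1 u2 v2 x -> `|'D_(basis_vec R a) f x| <= c * f x) ->
  rect u1 v1 u2 v2 q -> f q = 0 -> forall x, rect u1 v1 u2 v2 x -> f x = 0.
Proof.
move=> sf f0 fb [q1 q2] fq x [x1 x2].
have fh : f (x.1, q.2) = 0.
  apply: (@gronwall_zero (fun t => f (axis 0 t q.2))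
    (fun t => 'D_(basis_vec R 0) f (axis 0 t q.2)) u1 v1 c q.1) => //.
  - by move=> t tu; apply: smooth_open_is_derive sf _.
  - by move=> t tu; apply: f0.
  - by move=> t tu; apply: fb.
  - by rewrite /axis /= -surjective_pairing.
rewrite (surjective_pairing x).
apply: (@gronwall_zero (fun t => f (axis 1 t x.1))
  (fun t => 'D_(basis_vec R 1) f (axis 1 t x.1)) u2 v2 c q.2) => //.
- by move=> t tu; apply: smooth_open_is_derive sf _.
- by move=> t tu; apply: f0.
- by move=> t tu; apply: fb.
Qed.

Lemma rect_open u1 v1 u2 v2 : open (rect u1 v1 u2 v2).
Proof.
have -> : rect u1 v1 u2 v2 = (fst @^-1` `]u1, v1[%classic) `&` (snd @^-1` `]u2, v2[%classic).
  by apply/seteqP; split.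
apply: openI; apply: open_comp; try exact: interval_open.
- by move=> x _; exact: cvg_fst.
- by move=> x _; exact: cvg_snd.
Qed.

End Slices.

(** * Bump functions *)

Section Flat.
Context {R : realType}.
Implicit Types (p : {poly R}) (t : R).

(** The polynomial parameter makes the family closed under differentiation, so that smoothness
    becomes an induction; p = 1 is the usual function exp(- 1 / t). Flatness here is at 0 and has
    nothing to do with the musical [flat]. *)
Definition flat_fun p t : R := if 0 < t then p.[t^-1] * expR (- t^-1) else 0.

(** With u = 1 / t one has du/dt = - u^2, hence the derivative of p(u) exp(- u) is u^2 (p - p')(u)
    exp(- u). *)
Definition flat_deriv p : {poly R} := 'X^2 * (p - p^`()).

Lemma poly_exp_bound p :
  exists2 C : R, 0 <= C & forall u : R, 0 <= u -> `|p.[u] * expR (- u)| * u ^+ 2 <= C.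
Proof.
(* Termwise, u^n exp(- u) <= n! for u >= 0, with n = i + 2 because of the extra factor u^2. *)
exists (\sum_(i < size p) `|p`_i| * (i.+2)`!%:R).
  by apply: sumr_ge0 => i _; rewrite mulr_ge0.
move=> u u0; rewrite normrM (ger0_norm (expR_ge0 _)) horner_coef.
apply: (@le_trans _ _ (\sum_(i < size p) `|p`_i| * (u ^+ i.+2 * expR (- u)))).
  rewrite -mulrA.
  apply: (@le_trans _ _ ((\sum_(i < size p) `|p`_i * u ^+ i|) * (expR (- u) * u ^+ 2))).
    rewrite ler_wpM2r ?mulr_ge0 ?expR_ge0 ?exprn_ge0 //.
    exact: ler_norm_sum.
  rewrite mulr_suml; apply: ler_sum => i _.
  rewrite normrM (ger0_norm (exprn_ge0 _ u0)) -(addn2 i) exprD.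
  by rewrite [X in X <= _](_ : _ = `|p`_i| * (u ^+ i * u ^+ 2 * expR (- u))) //; ring.
apply: ler_sum => i _; rewrite ler_wpM2l //.
rewrite expRN ler_pdivrMr ?expR_gt0 // mulrC.
rewrite -ler_pdivrMr ?ltr0n ?fact_gt0 //.
by apply: le_trans (expR_ge1Dxn i.+1 u0); rewrite lerDr.
Qed.

(** Quadratic decay makes the difference quotient at 0 tend to 0; the factor u^2 in [poly_exp_bound]
    is there for this. *)
Lemma flat_fun_bound p : exists2 C : R, 0 < C & forall t, `|flat_fun p t| <= C * t ^+ 2.
Proof.
have [C C0 CP] := poly_exp_bound p; exists (C + 1); first exact: ltr_wpDl.
move=> t; rewrite /flat_fun; case: ifP => t0.
  have ti : 0 <= t^-1 by rewrite invr_ge0 ltW.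
  have := CP _ ti; rewrite exprVn ler_pdivrMr ?exprn_gt0 // => /le_trans; apply.
  by rewrite ler_wpM2r ?sqr_ge0 // lerDl.
by rewrite normr0 mulr_ge0 ?sqr_ge0 // addr_ge0.
Qed.

Lemma is_derive_flat_fun p t : is_derive t 1 (flat_fun p) (flat_fun (flat_deriv p) t).
Proof.
have [t0|t0|t0] := ltgtP t 0.
- rewrite [X in is_derive _ _ _ X](_ : _ = 0); last first.
    by rewrite /flat_fun ltNge ltW.
  apply: (@near_eq_is_derive _ _ _ (fun=> 0)).
    near=> s; rewrite /flat_fun ltNge ltW //.
    by near: s; exact: lt_nbhsl.
- rewrite [X in is_derive _ _ _ X](_ : _ = (flat_deriv p).[t^-1] * expR (- t^-1)); last first.
    by rewrite /flat_fun t0.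
  apply: (@near_eq_is_derive R R R (fun s : R => p.[s^-1] * expR (- s^-1))).
    near=> s; rewrite /flat_fun.
    have -> // : 0 < s by near: s; exact: lt_nbhsr.
  have n0 : t != 0 by rewrite gt_eqF.
  have di : is_derive t 1 (fun s : R => s^-1) (- t ^- 2).
    split; first exact: derivableV.
    by rewrite deriveV // derive_id [_ *: _]mulr1.
  have dp : is_derive t 1 (fun s => p.[s^-1]) (p^`().[t^-1] * (- t ^- 2)).
    exact: (@is_derive1_comp R (horner p) (fun s => s^-1) t _ _ (is_derive_poly p _) di).
  have de : is_derive t 1 (fun s => expR (- s^-1)) (expR (- t^-1) * (t ^- 2)).
    have dN : is_derive t 1 (fun s : R => - s^-1) (t ^- 2).
      by have := @is_deriveN _ _ _ _ _ _ _ di; rewrite opprK.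
    exact: (@is_derive1_comp R (@expR R) (fun s => - s^-1) t _ _ (is_derive_expR _) dN).
  have fg := @is_deriveM _ _ _ _ _ _ _ _ dp de.
  apply: (is_derive_eq fg).
  rewrite /flat_deriv !hornerE /GRing.scale /= -exprVn; ring.
- rewrite t0 [X in is_derive _ _ _ X](_ : _ = 0); last by rewrite /flat_fun ltxx.
  have [C C0 CP] := flat_fun_bound p.
  have c0 : (fun h => h^-1 *: ((flat_fun p \o shift 0) (h *: 1) - flat_fun p 0)) @ 0^' --> (0 : R).
    apply/cvgrPdist_le => e e0; near=> h.
    have hn0 : h != 0 by near: h; exact: nbhs_dnbhs_neq.
    rewrite sub0r normrN /= addr0 [_ *: 1]mulr1 {2}/flat_fun ltxx subr0.
    rewrite normrZ normfV ler_pdivrMl ?normr_gt0 //.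
    apply: (le_trans (CP h)); rewrite -real_normK ?num_real // expr2 mulrA mulrC.
    rewrite ler_wpM2l // mulrC -ler_pdivlMr //.
    by near: h; apply: dnbhs0_le; rewrite divr_gt0.
  split; [by apply/cvg_ex; exists 0|exact: cvg_lim].
Unshelve. all: by end_near. Qed.

End Flat.

Section Bump.
Context {R : realType}.
Implicit Types (p : {poly R}) (x : R * R).

Lemma is_derive_line (F : R * R -> R) x (v : R * R) (d : R) :
  is_derive (0 : R) (1 : R) (fun h : R => F (h *: v + x)) d -> is_derive x v F d.
Proof.
have E : (fun h : R => h^-1 *: (((fun h : R => F (h *: v + x)) \o shift 0) (h *: (1 : R)) -
            F ((0 : R) *: v + x))) =
         (fun h => h^-1 *: ((F \o shift x) (h *: v) - F x)).
  by apply/funext => h /=; rewrite scale0r add0r addr0 [h *: 1]mulr1.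
by case=> df dF; split; [rewrite /derivable -E|rewrite /derive -E].
Qed.

Definition affine (s1 s2 c : R) x : R := s1 * x.1 + s2 * x.2 + c.

Lemma is_derive_flat_affine p s1 s2 c (a : 'I_2) x :
  is_derive x (basis_vec R a) (fun y => flat_fun p (affine s1 s2 c y))
    ((if a == 0 then s1 else s2) * flat_fun (flat_deriv p) (affine s1 s2 c x)).
Proof.
apply: is_derive_line.
set s := (if a == 0 then s1 else s2).
have E h : affine s1 s2 c (h *: basis_vec R a + x) = s * h + affine s1 s2 c x.
  rewrite /affine /s /basis_vec; case: ifP => _ /=;
    rewrite /GRing.scale /= ?mulr1 ?mulr0 ?add0r; ring.
under eq_fun do rewrite E.
have kd : is_derive (0 : R) (1 : R) (fun h : R => s * h + affine s1 s2 c x) s.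
  have := @is_deriveD R R R (fun h => s * h) (cst (affine s1 s2 c x)) 0 1 s 0 _ _.
  rewrite addr0; apply.
    have := @is_deriveZ R R R id s 0 1 1 (is_derive_id _ _).
    by rewrite [s *: (1 : R)]mulr1.
have := @is_derive1_comp R (flat_fun p) (fun h => s * h + affine s1 s2 c x) 0 _ s _ kd.
rewrite mulr0 add0r mulrC; apply.
exact: is_derive_flat_fun.
Qed.

Lemma continuous_flat_affine p s1 s2 c : continuous (fun x => flat_fun p (affine s1 s2 c x)).
Proof.
move=> x; apply: (@continuous_comp _ _ _ (affine s1 s2 c) (flat_fun p)).
  apply: cvgD; last exact: cvg_cst.
  by apply: cvgD; apply: cvgM; [exact: cvg_cst|exact: cvg_fst|exact: cvg_cst|exact: cvg_snd].
apply: differentiable_continuous; apply/derivable1_diffP.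
by have [] := is_derive_flat_fun p (affine s1 s2 c x).
Qed.

Lemma smooth_flat_affine p s1 s2 c :
  smooth_open setT (fun x => flat_fun p (affine s1 s2 c x)).
Proof.
move=> k; elim: k p => [|k IH] p; split=> //; try by move=> x _; exact: continuous_flat_affine.
move=> a; split; first by move=> x _; have [] := is_derive_flat_affine p s1 s2 c a x.
have sa := class_C_cst k (@setT (R * R)) (if a == 0 then s1 else s2).
apply: (class_C_eq openT _ (class_CM openT sa (IH (flat_deriv p)))) => x _.
by have [_ ->] := is_derive_flat_affine p s1 s2 c a x.
Qed.

(** One flat factor for each side of the square of half-side r about x0; each vanishes beyond its
    own side. *)
Definition bump_fun (x0 : R * R) (r : R) x : R :=
  flat_fun 1 (affine 1 0 (r - x0.1) x) * flat_fun 1 (affine (-1) 0 (r + x0.1) x) *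
  (flat_fun 1 (affine 0 1 (r - x0.2) x) * flat_fun 1 (affine 0 (-1) (r + x0.2) x)).

Lemma bump_smooth x0 r : smooth_open setT (bump_fun x0 r).
Proof.
by move=> k; apply: class_CM; [exact: openT| |];
  apply: class_CM; try exact: openT; exact: smooth_flat_affine.
Qed.

Lemma flat_fun_ge0 (t : R) : 0 <= flat_fun 1 t.
Proof. by rewrite /flat_fun; case: ifP => // _; rewrite hornerC mul1r expR_ge0. Qed.

Lemma flat_fun_le0 p (t : R) : t <= 0 -> flat_fun p t = 0.
Proof. by rewrite /flat_fun ltNge => ->. Qed.

Lemma flat_fun_ge (s t : R) : 0 < s -> s <= t -> expR (- s^-1) <= flat_fun 1 t.
Proof.
move=> s0 st; rewrite /flat_fun (lt_le_trans s0 st) hornerC mul1r ler_expR lerN2.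
by rewrite lef_pV2 // posrE (lt_le_trans s0 st).
Qed.

Lemma bump_ge0 x0 r x : 0 <= bump_fun x0 r x.
Proof. by rewrite /bump_fun !mulr_ge0 // flat_fun_ge0. Qed.

Lemma bump_out x0 r x : ~~ (`|x.1 - x0.1| < r) || ~~ (`|x.2 - x0.2| < r) ->
  bump_fun x0 r x = 0.
Proof.
rewrite /bump_fun !ltr_norml !negb_and -!leNgt /affine !mul0r !addr0 !add0r !mul1r !mulN1r.
by move=> /orP[/orP[]|/orP[]] H;
  [rewrite (@flat_fun_le0 1 (x.1 + (r - x0.1)))|rewrite (@flat_fun_le0 1 (- x.1 + (r + x0.1)))
  |rewrite (@flat_fun_le0 1 (x.2 + (r - x0.2)))|rewrite (@flat_fun_le0 1 (- x.2 + (r + x0.2)))];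
  rewrite ?mul0r ?mulr0 ?mul0r //; lra.
Qed.

(** On the square of half the size all four affine arguments are at least r / 2, whence the fourth
    power. *)
Lemma bump_in x0 r x : 0 < r -> `|x.1 - x0.1| <= r / 2 -> `|x.2 - x0.2| <= r / 2 ->
  expR (- (r / 2)^-1) ^+ 4 <= bump_fun x0 r x.
Proof.
move=> r0; rewrite !ler_norml => /andP[h1 h2] /andP[h3 h4].
have r20 : 0 < r / 2 by rewrite divr_gt0.
have e0 := expR_ge0 (- (r / 2)^-1).
rewrite /bump_fun (exprD _ 2 2) !expr2.
by apply: ler_pM; rewrite ?mulr_ge0 //; apply: ler_pM => //;
  apply: flat_fun_ge => //; rewrite /affine; lra.
Qed.

End Bump.

(** * The weak divergence in the plane *)

Section PlaneMeasure.
Context {R : realType}.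
Notation mu := (@lebesgue_measure R).
Notation mu2 := (@lebesgue_measure R \x @lebesgue_measure R)%E.
Implicit Types (f : R * R -> R) (W A : set (R * R)).

(** Measurability refers to the product sigma-algebra, so W is written as a countable union of
    products of intervals with rational centres and radii 1 / (n + 1). *)
Lemma measurable_open_plane W : open W ->
  measurable (W : set (measurableTypeR R * measurableTypeR R)).
Proof.
move=> oW.
pose B (i : rat * rat * nat) : set (R * R) :=
  [set y | `|y.1 - ratr i.1.1| < i.2.+1%:R^-1] `&`
  [set y | `|y.2 - ratr i.1.2| < i.2.+1%:R^-1].
(* Boxes that are not inside W are replaced by the empty set, so that the union can run over the
   whole countable index type. *)
pose G (i : rat * rat * nat) := if `[< B i `<=` W >] then B i else set0.
have -> : W = \bigcup_i G i.
  apply/seteqP; split=> [x Wx|x [i _]]; last first.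
    by rewrite /G; case: asboolP => // BW; exact: BW.
  have /nbhs_ballP[e /= e0 eW] : nbhs x W by exact: open_nbhs_nbhs.
  have [n n0] : exists n : nat, n.+1%:R^-1 < e / 2 :> R.
    have e20 : 0 < e / 2 by rewrite divr_gt0.
    exists (Num.truncn (e / 2)^-1); rewrite -[ltRHS]invrK ltf_pV2 ?posrE ?invr_gt0 //.
    exact: Num.Theory.truncnS_gt.
  have n1 : (0 : R) < n.+1%:R^-1 by rewrite invr_gt0.
  have lt1 (a d : R) : 0 < d -> a - d < a + d by move=> d0; lra.
  have lt2 (a b d : R) : a - d < b -> b < a + d -> `|a - b| < d.
    by move=> ? ?; rewrite ltr_norml; apply/andP; split; lra.
  have lt3 (a b c d : R) : `|a - c| < d -> `|b - c| < d -> d < e / 2 -> `|a - b| < e.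
    move=> ac bc de; rewrite (_ : a - b = (a - c) - (b - c)); last by ring.
    by apply: (le_lt_trans (ler_normB _ _)); lra.
  have [q1 +] : exists q, ratr q \in `]x.1 - n.+1%:R^-1, x.1 + n.+1%:R^-1[.
    by apply: rat_in_itvoo; exact: lt1.
  have [q2 +] : exists q, ratr q \in `]x.2 - n.+1%:R^-1, x.2 + n.+1%:R^-1[.
    by apply: rat_in_itvoo; exact: lt1.
  rewrite !in_itv /= => /andP[h1 h2] /andP[h3 h4].
  have Bx : B (q1, q2, n) x by split; exact: lt2.
  exists (q1, q2, n) => //; rewrite /G asboolT //.
  move=> y [/= y1 y2]; apply: eW; split; rewrite /ball /=.
    by apply: (lt3 _ _ (ratr q1) _ _ y1 n0); case: Bx.
  by apply: (lt3 _ _ (ratr q2) _ _ y2 n0); case: Bx.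
apply: countable_bigcupT_measurable; first exact: countableP.
move=> i; rewrite /G; case: asboolP => // _.
have -> : B i = ball (ratr i.1.1 : R) (i.2.+1%:R^-1 : R) `*`
                ball (ratr i.1.2 : R) (i.2.+1%:R^-1 : R).
  by apply/seteqP; split => y [/= y1 y2]; split; rewrite /ball /=; rewrite distrC.
by apply: measurableX; apply: open_measurable; exact: ball_open.
Qed.

Definition crect (u1 v1 u2 v2 : R) : set (R * R) := `[u1, v1]%classic `*` `[u2, v2]%classic.

Lemma crect_compact u1 v1 u2 v2 : compact (crect u1 v1 u2 v2).
Proof. by apply: compact_setX; exact: segment_compact. Qed.

Lemma crect_measurable u1 v1 u2 v2 :
  measurable (crect u1 v1 u2 v2 : set (measurableTypeR R * measurableTypeR R)).
Proof. by apply: measurableX; exact: measurable_itv. Qed.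

Lemma crect_measure u1 v1 u2 v2 : u1 < v1 -> u2 < v2 ->
  mu2 (crect u1 v1 u2 v2) = ((v1 - u1) * (v2 - u2))%:E.
Proof.
move=> h1 h2; rewrite product_measure1E; try exact: measurable_itv.
have L (a b : R) : a < b -> mu `[a, b]%classic = (b - a)%:E.
  by move=> ab; rewrite lebesgue_measure_itv /= lte_fin ab EFinD.
by rewrite EFinM; congr (_ * _)%E; exact: L.
Qed.

Lemma crect_integrable u1 v1 u2 v2 W f : u1 < v1 -> u2 < v2 -> open W ->
  crect u1 v1 u2 v2 `<=` W -> (forall x, W x -> {for x, continuous f}) ->
  mu2.-integrable (crect u1 v1 u2 v2) (EFin \o f).
Proof.
move=> h1 h2 oW QW cf; apply: measurable_bounded_integrable.
- exact: crect_measurable.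
- apply: (@le_lt_trans _ _ ((v1 - u1) * (v2 - u2))%:E); last exact: ltry.
  by rewrite le_eqVlt; apply/orP; left; apply/eqP; exact: crect_measure.
- apply: (measurability _ (RGenOpens.measurableE R)).
  move=> _ [_ [a [b ->] <-]].
  (* Continuity on the open set W, and not merely on the rectangle, makes the preimage inside W
     open, to which [measurable_open_plane] applies. *)
  have -> : crect u1 v1 u2 v2 `&` f @^-1` `]a, b[%classic =
            crect u1 v1 u2 v2 `&` (W `&` f @^-1` `]a, b[%classic).
    by apply/seteqP; split=> x [Qx]; [move=> fx|case=> Wx fx]; split=> //; split=> //; exact: QW.
  apply: measurableI; first exact: crect_measurable.
  apply: measurable_open_plane; rewrite openE => x [Wx fx].
  apply: filterI; first exact: open_nbhs_nbhs.
  by apply: (cf x Wx); apply: open_nbhs_nbhs; split => //; exact: interval_open.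
- have cQ : {within crect u1 v1 u2 v2, continuous f}.
    by apply: continuous_in_subspaceT => x /set_mem Qx; apply: cf; exact: QW.
  have /compact_bounded[M [_ mrt]] := continuous_compact cQ (@crect_compact u1 v1 u2 v2).
  by exists M; split; rewrite ?num_real // => ? ? ? ?; exact: mrt.
Qed.

End PlaneMeasure.

(** * Integration of derivatives over a rectangle *)

Section WeakStrong.
Context {R : realType}.
Notation mu := (@lebesgue_measure R).
Notation mu2 := (@lebesgue_measure R \x @lebesgue_measure R)%E.
Implicit Types (f : R * R -> R) (W A : set (R * R)).

Lemma integral_slice W f a (u v s : R) : smooth_open W f -> u < v ->
  (forall t, t \in `[u, v] -> W (axis a t s)) ->
  f (axis a u s) = 0 -> f (axis a v s) = 0 ->
  (\int[mu]_(t in `[u, v]) ('D_(basis_vec R a) f (axis a t s))%:E = 0)%E.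
Proof.
move=> sf uv Ws fu fv.
pose F t := f (axis a t s).
have Fd t : t \in `[u, v] -> is_derive t 1 F ('D_(basis_vec R a) f (axis a t s)).
  by move=> tu; apply: smooth_open_is_derive sf _; exact: Ws.
have FF t : t \in `[u, v] -> {for t, continuous F}.
  by move=> /Fd[dF _]; apply: differentiable_continuous; exact/derivable1_diffP.
have uI : u \in `[u, v] by rewrite in_itv /= lexx ltW.
have vI : v \in `[u, v] by rewrite in_itv /= lexx ltW.
rewrite (@continuous_FTC2 R _ F u v) //; first by rewrite /F fu fv subee.
- apply: (@continuous_is_derive R _
    (fun t => 'D_(basis_vec R a) (fun y => 'D_(basis_vec R a) f y) (axis a t s))) => t tu.
  by apply: (smooth_open_is_derive (smooth_open_derive a sf)); exact: Ws.
- split.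
  + by move=> t tu; have [] := Fd t (subset_itv_oo_cc tu).
  + by apply: cvg_at_right_filter; exact: FF.
  + by apply: cvg_at_left_filter; exact: FF.
- by move=> t tu; rewrite derive1E; have [_ ->] := Fd t (subset_itv_oo_cc tu).
Qed.

(** By Fubini, integrating first in the direction of the derivative: every slice contributes zero by
    the fundamental theorem of calculus. *)
Lemma integral_derive_rect W f a u1 v1 u2 v2 : open W -> smooth_open W f ->
  u1 < v1 -> u2 < v2 -> crect u1 v1 u2 v2 `<=` W ->
  (forall x, crect u1 v1 u2 v2 x ->
     (x.1 \in [:: u1; v1]) || (x.2 \in [:: u2; v2]) -> f x = 0) ->
  \int[mu2]_(x in crect u1 v1 u2 v2) 'D_(basis_vec R a) f x = 0.
Proof.
move=> oW sf h1 h2 QW f0.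
set Q := crect u1 v1 u2 v2 in QW f0 *.
(* Extension by zero, since Fubini's theorem is applied over the whole plane. *)
pose g := (fun x => 'D_(basis_vec R a) f x) \_ Q.
have ig : mu2.-integrable setT (EFin \o g).
  have iQ : mu2.-integrable Q (EFin \o (fun x => 'D_(basis_vec R a) f x)).
    apply: (crect_integrable h1 h2 oW QW) => x Wx.
    exact: smooth_open_continuous (smooth_open_derive a sf) Wx.
  by rewrite -restrict_EFin; exact: (integrable_mkcond _ (@crect_measurable R u1 v1 u2 v2)).1 iQ.
rewrite Rintegral_mkcond /Rintegral -/g.
have u1I : u1 \in `[u1, v1] by rewrite in_itv /= lexx ltW.
have v1I : v1 \in `[u1, v1] by rewrite in_itv /= lexx ltW.
have u2I : u2 \in `[u2, v2] by rewrite in_itv /= lexx ltW.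
have v2I : v2 \in `[u2, v2] by rewrite in_itv /= lexx ltW.
have mkT (T : Type) (A : set T) (z : T) : A z -> (z \in A) = true.
  by move=> Az; apply: mem_set.
have mkF (T : Type) (A : set T) (z : T) : ~ A z -> (z \in A) = false.
  by move=> Az; apply: memNset.
have [a0|a1] := eqVneq a 0.
  rewrite -(integral21_prod_meas1 ig) (_ : (\int[_]_y _ = 0)%E) //.
  apply: integral0_eq => y _; rewrite /fubini_G.
  have [yI|yI] := boolP (y \in `[u2, v2]); last first.
    apply: integral0_eq => x _; rewrite /= /g patchN // notin_setE => -[_ /=].
    by apply/negP.
  rewrite -[RHS](@integral_slice W f a u1 v1 y sf h1).
  - rewrite [RHS]integral_mkcond; apply: eq_integral => x _.
    rewrite /= /patch /g /patch /axis a0 /=.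
    have [xI|xI] := boolP (x \in `[u1, v1]).
      by rewrite (mkT _ Q (x, y)) // (mkT _ _ x).
    rewrite (mkF _ Q (x, y)); last by move=> [/= xx _]; rewrite xx in xI.
    by rewrite (mkF _ _ x) // => /= xx; rewrite xx in xI.
  - by move=> t tI; apply: QW; rewrite /axis a0 /=; split.
  - rewrite /axis a0 /=; apply: f0; first by split.
    by apply/orP; left; rewrite /= inE eqxx.
  - rewrite /axis a0 /=; apply: f0; first by split.
    by apply/orP; left; rewrite /= !inE eqxx orbT.
have a0 : (a == 0) = false by exact/negbTE.
rewrite -(integral12_prod_meas1 ig) (_ : (\int[_]_y _ = 0)%E) //.
apply: integral0_eq => y _; rewrite /fubini_F.
have [yI|yI] := boolP (y \in `[u1, v1]); last first.
  apply: integral0_eq => x _; rewrite /= /g patchN // notin_setE => -[/= + _].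
  by apply/negP.
rewrite -[RHS](@integral_slice W f a u2 v2 y sf h2).
- rewrite [RHS]integral_mkcond; apply: eq_integral => x _.
  rewrite /= /patch /g /patch /axis a0 /=.
  have [xI|xI] := boolP (x \in `[u2, v2]).
    by rewrite (mkT _ Q (y, x)) // (mkT _ _ x).
  rewrite (mkF _ Q (y, x)); last by move=> [/= _ xx]; rewrite xx in xI.
  by rewrite (mkF _ _ x) // => /= xx; rewrite xx in xI.
- by move=> t tI; apply: QW; rewrite /axis a0 /=; split.
- rewrite /axis a0 /=; apply: f0; first by split.
  by apply/orP; right; rewrite /= inE eqxx.
- rewrite /axis a0 /=; apply: f0; first by split.
  by apply/orP; right; rewrite /= !inE eqxx orbT.
Qed.

End WeakStrong.

(** * From the weak divergence identity to the pointwise one *)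

Section Codiff.
Context {R : realType}.
Notation mu := (@lebesgue_measure R).
Notation mu2 := (@lebesgue_measure R \x @lebesgue_measure R)%E.
Implicit Types (f g P Q S phi : R * R -> R) (W A : set (R * R)).

Lemma Rintegral_support A B f : B `<=` A -> (forall x, ~ B x -> f x = 0) ->
  \int[mu2]_(x in A) f x = \int[mu2]_(x in B) f x.
Proof.
move=> BA f0; rewrite Rintegral_mkcond [RHS]Rintegral_mkcond; suff -> : f \_ A = f \_ B by [].
apply/funext => x; rewrite /patch.
have [Bx|Bx] := pselect (B x); first by rewrite !mem_set //; exact: BA.
by rewrite (memNset Bx) f0 // if_same.
Qed.

Definition square (x : R * R) (r : R) : set (R * R) :=
  crect (x.1 - r) (x.1 + r) (x.2 - r) (x.2 + r).

Lemma square_lt (u r : R) : 0 < r -> u - r < u + r.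
Proof. by move=> r0; lra. Qed.

Lemma squareP x r y : square x r y <-> `|y.1 - x.1| <= r /\ `|y.2 - x.2| <= r.
Proof.
rewrite /square /crect /setX /= !in_itv /= !ler_norml.
by split=> -[h1 h2]; split; lra.
Qed.

Lemma square_subset x r r' : r' <= r -> square x r' `<=` square x r.
Proof.
by move=> rr y /squareP[h1 h2]; apply/squareP; split; [exact: le_trans rr|exact: le_trans rr].
Qed.

Lemma square_integrable x r W f : 0 < r -> open W -> square x r `<=` W ->
  (forall x, W x -> {for x, continuous f}) ->
  mu2.-integrable (square x r) (EFin \o f).
Proof. by move=> r0; apply: crect_integrable; exact: square_lt. Qed.

Lemma bump_test W x0 r : square x0 r `<=` W -> smooth_open setT (bump_fun x0 r) /\
  exists2 C : set (R * R), compact C & C `<=` W /\ forall x, ~ C x -> bump_fun x0 r x = 0.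
Proof.
move=> QW; split; first exact: bump_smooth.
exists (square x0 r); first exact: crect_compact.
split=> // x nQ; apply: bump_out; rewrite -negb_and; apply/negP => /andP[/ltW h1 /ltW h2].
by apply: nQ; apply/squareP.
Qed.

Lemma derive_bump_out a x0 r x : ~ square x0 r x -> 'D_(basis_vec R a) (bump_fun x0 r) x = 0.
Proof.
move=> nQ; have [_ [C _ [_ C0]]] := bump_test (@subset_refl _ (square x0 r)).
rewrite (near_eq_derive (g := fun=> 0)); first exact: derive_cst.
have oQ : open (~` square x0 r).
  apply: closed_openC; apply: compact_closed; last exact: crect_compact.
  exact: norm_hausdorff.
have : nbhs x (~` square x0 r) by exact: open_nbhs_nbhs.
apply: filterS => y nQy; apply: bump_out; rewrite -negb_and; apply/negP => /andP[/ltW h1 /ltW h2].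
by apply: nQy; apply/squareP.
Qed.

Lemma nbhs_closed_square x A : nbhs x A -> exists2 r : R, 0 < r & square x r `<=` A.
Proof.
move=> /nbhs_ballP[r /= r0 rA]; exists (r / 2); first exact: divr_gt0.
by move=> y /squareP[h1 h2]; apply: rA; split; rewrite /ball /= distrC; lra.
Qed.

(** The weak form of Q = - div (P, S) for Lebesgue measure; in the applications the Riemannian
    density is absorbed into P, S and Q. *)
Definition weak_divergence W P S Q :=
  forall phi, smooth_open setT phi ->
    (exists2 C : set (R * R), compact C & C `<=` W /\ forall x, ~ C x -> phi x = 0) ->
    \int[mu2]_(x in W) ('D_(basis_vec R 0) phi x * P x + 'D_(basis_vec R 1) phi x * S x)
    = \int[mu2]_(x in W) (phi x * Q x).

(** If the residual c were positive at x0, it would be so on a small square, and its integral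
    against a bump supported there would be positive; integration by parts and the weak identity
    make that integral zero. *)
Lemma weak_divergence_le W P S Q x0 : open W ->
  smooth_open W P -> smooth_open W S -> smooth_open W Q ->
  weak_divergence W P S Q -> W x0 ->
  Q x0 + ('D_(basis_vec R 0) P x0 + 'D_(basis_vec R 1) S x0) <= 0.
Proof.
move=> oW sP sS sQ wk Wx0; rewrite leNgt; apply/negP.
pose c x := Q x + ('D_(basis_vec R 0) P x + 'D_(basis_vec R 1) S x).
rewrite -/(c x0) => c0.
have cc x : W x -> {for x, continuous c}.
  move=> Wx; apply: continuousD; first exact: smooth_open_continuous sQ Wx.
  by apply: continuousD; [exact: smooth_open_continuous (smooth_open_derive 0 sP) Wx
    |exact: smooth_open_continuous (smooth_open_derive 1 sS) Wx].
have nc : nbhs x0 (c @^-1` [set y | c x0 / 2 < y]).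
  apply: (cc x0 Wx0); apply: open_nbhs_nbhs; split; first exact: open_gt.
  by rewrite /=; lra.
have [r r0 QWc] := nbhs_closed_square (filterI (open_nbhs_nbhs (conj oW Wx0)) nc).
have QW : square x0 r `<=` W by move=> x /QWc[].
have Qc x : square x0 r x -> c x0 / 2 < c x by move=> /QWc[].
pose phi := bump_fun x0 r.
have [sphi tphi] := bump_test QW.
have sphiW : smooth_open W phi by apply: smooth_open_subset sphi.
have := wk phi sphi tphi.
have phi0 x : ~ square x0 r x -> phi x = 0.
  move=> nQ; apply: bump_out; rewrite -negb_and; apply/negP => /andP[/ltW h1 /ltW h2].
  by apply: nQ; apply/squareP.
rewrite (Rintegral_support QW); last first.
  by move=> x nQ; rewrite !derive_bump_out // !mul0r addr0.
rewrite (Rintegral_support (f := fun x => phi x * Q x) QW); last first.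
  by move=> x nQ; rewrite phi0 // mul0r.
move=> E.
have smM g : smooth_open W g -> smooth_open W (fun x => phi x * g x).
  by move=> sg k; exact: class_CM.
have side x : square x0 r x ->
    (x.1 \in [:: x0.1 - r; x0.1 + r]) || (x.2 \in [:: x0.2 - r; x0.2 + r]) -> phi x = 0.
  move=> _; rewrite !inE => H; apply: bump_out.
  have n1 : `|r| = r by rewrite gtr0_norm.
  by case/orP: H => /orP[] /eqP ->; rewrite addrAC subrr add0r ?normrN n1 ltxx ?orbT.
have I0 : \int[mu2]_(x in square x0 r) 'D_(basis_vec R 0) (fun x => phi x * P x) x = 0.
  apply: (integral_derive_rect 0 oW (smM _ sP) (square_lt _ r0) (square_lt _ r0) QW).
  by move=> x Qx sx; rewrite side // mul0r.
have I1 : \int[mu2]_(x in square x0 r) 'D_(basis_vec R 1) (fun x => phi x * S x) x = 0.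
  apply: (integral_derive_rect 1 oW (smM _ sS) (square_lt _ r0) (square_lt _ r0) QW).
  by move=> x Qx sx; rewrite side // mul0r.
have int g : (forall x, W x -> {for x, continuous g}) ->
    mu2.-integrable (square x0 r) (EFin \o g) by exact: square_integrable.
have cd g a : smooth_open W g -> forall x, W x -> {for x, continuous ('D_(basis_vec R a) g)}.
  by move=> sg x Wx; exact: smooth_open_continuous (smooth_open_derive a sg) Wx.
have cm g : smooth_open W g -> forall x, W x -> {for x, continuous g}.
  by move=> sg x Wx; exact: smooth_open_continuous sg Wx.
have mQ := @crect_measurable R (x0.1 - r) (x0.1 + r) (x0.2 - r) (x0.2 + r).
have Z : \int[mu2]_(x in square x0 r) (phi x * c x) = 0.
  pose d x := 'D_(basis_vec R 0) phi x * P x + 'D_(basis_vec R 1) phi x * S x.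
  have cdd x : W x -> {for x, continuous d}.
    move=> Wx; apply: continuousD; apply: continuousM.
    - exact: cd sphiW _ Wx.
    - exact: cm sP _ Wx.
    - exact: cd sphiW _ Wx.
    - exact: cm sS _ Wx.
  (* Splits phi c into the difference of the two weak integrands and the derivatives of phi P and
     phi S; each of these pieces integrates to zero. *)
  have alg (p q p0 p1 u u0 v v1 : R) : p * (q + (u0 + v1)) =
      (p * q - (p0 * u + p1 * v)) + ((p * u0 + u * p0) + (p * v1 + v * p1)) by ring.
  transitivity (\int[mu2]_(x in square x0 r) ((phi x * Q x - d x) +
     ('D_(basis_vec R 0) (fun x => phi x * P x) x + 'D_(basis_vec R 1) (fun x => phi x * S x) x))).
    apply: eq_Rintegral => x /set_mem Qx; have Wx := QW _ Qx.
    have dphi a := @smooth_open_derivable R W phi a x sphiW Wx.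
    rewrite [X in _ = _ + (X + _)](deriveM (dphi 0) (@smooth_open_derivable R W P 0 x sP Wx)).
    rewrite [X in _ = _ + (_ + X)](deriveM (dphi 1) (@smooth_open_derivable R W S 1 x sS Wx)).
    exact: alg.
  rewrite RintegralD //; last first.
  - apply: int => x Wx; apply: continuousD; [exact: cd (smM _ sP) _ Wx|exact: cd (smM _ sS) _ Wx].
  - apply: int => x Wx; apply: continuousB; [exact: cm (smM _ sQ) _ Wx|exact: cdd].
  rewrite RintegralB //; last first.
  - exact: int.
  - by apply: int; exact: cm (smM _ sQ).
  rewrite [X in _ + X]RintegralD //; last first.
  - by apply: int; exact: cd (smM _ sS).
  - by apply: int; exact: cd (smM _ sP).
  by rewrite I0 I1 -E /d subrr !addr0.
have r20 : 0 < r / 2 by rewrite divr_gt0.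
have Qin : square x0 (r / 2) `<=` square x0 r.
  by apply: square_subset; rewrite ler_pdivrMr // ler_peMr ?ler1n // ltW.
have mQin := @crect_measurable R (x0.1 - r / 2) (x0.1 + r / 2) (x0.2 - r / 2) (x0.2 + r / 2).
(* A lower bound for phi c on the half-size square: the minimum from [bump_in] times the bound c x0
   / 2. *)
pose k := expR (- (r / 2)^-1) ^+ 4 * (c x0 / 2).
have k0 : 0 < k by rewrite mulr_gt0 ?exprn_gt0 ?expR_gt0 // divr_gt0.
have cphi x : W x -> {for x, continuous (fun x => phi x * c x)}.
  by move=> Wx; apply: continuousM; [exact: cm sphiW _ Wx|exact: cc].
have intin g : (forall x, W x -> {for x, continuous g}) ->
    mu2.-integrable (square x0 (r / 2)) (EFin \o g).
  by apply: square_integrable => // x /Qin/QW.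
have L1 : \int[mu2]_(x in square x0 (r / 2)) k <=
          \int[mu2]_(x in square x0 (r / 2)) (phi x * c x).
  apply: le_Rintegral => //; [by apply: intin => x _; exact: cvg_cst|exact: intin|].
  move=> x Qx; have /squareP[h1 h2] := Qx.
  apply: ler_pM; rewrite ?exprn_ge0 ?expR_ge0 ?divr_ge0 ?(ltW c0) //.
    exact: bump_in.
  by apply: ltW; apply: Qc; exact: Qin.
have L2 : \int[mu2]_(x in square x0 (r / 2)) (phi x * c x) <=
          \int[mu2]_(x in square x0 r) (phi x * c x).
  rewrite /Rintegral; apply: fine_le.
  - exact: (integrable_fin_num mQin (intin _ cphi)).
  - exact: (integrable_fin_num mQ (int _ cphi)).
  apply: ge0_subset_integral => //.
    by have /integrableP[] := int _ cphi.
  move=> x Qx; rewrite lee_fin mulr_ge0 ?bump_ge0 //.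
  by apply: ltW; apply: lt_trans (Qc _ Qx); exact: divr_gt0.
have L3 : 0 < \int[mu2]_(x in square x0 (r / 2)) k.
  rewrite Rintegral_cst // mulr_gt0 //.
  rewrite [X in _ < X](_ : _ = r * r); first exact: mulr_gt0.
  transitivity (fine ((x0.1 + r / 2 - (x0.1 - r / 2)) * (x0.2 + r / 2 - (x0.2 - r / 2)))%:E).
    by congr fine; apply: crect_measure; exact: square_lt.
  by rewrite /=; field.
have := lt_le_trans L3 (le_trans L1 L2).
by rewrite Z ltxx.
Qed.

(** The opposite inequality is the previous lemma for - P, - S and - Q, whose weak identity is the
    original one tested against - phi. *)
Lemma weak_divergenceE W P S Q x : open W ->
  smooth_open W P -> smooth_open W S -> smooth_open W Q ->
  weak_divergence W P S Q -> W x ->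
  Q x = - ('D_(basis_vec R 0) P x + 'D_(basis_vec R 1) S x).
Proof.
move=> oW sP sS sQ wk Wx; apply/eqP; rewrite -addr_eq0 eq_le.
rewrite (weak_divergence_le oW sP sS sQ wk Wx) /=.
have smN g : smooth_open W g -> smooth_open W (- g).
  move=> sg k; apply: class_C_eq (class_CM oW (class_C_cst k W (-1)) (sg k)) => // y _.
  by rewrite mulN1r.
have wkN : weak_divergence W (- P) (- S) (- Q).
  move=> phi sphi [C cC [CW C0]].
  have sNphi : smooth_open setT (fun x => - phi x).
    move=> k; apply: class_C_eq (class_CM openT (class_C_cst k setT (-1)) (sphi k)) => //.
      exact: openT.
    by move=> y _; rewrite mulN1r.
  have := wk _ sNphi; rewrite (_ : \int[mu2]_(y in W) (- phi y * Q y) =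
     \int[mu2]_(y in W) (phi y * (- Q) y)); last first.
    by apply: eq_Rintegral => y _; rewrite mulNr -mulrN.
  move=> <-; last by exists C => //; split=> // y /C0 ->; rewrite oppr0.
  apply: eq_Rintegral => y _.
  have dphi a : derivable phi y (basis_vec R a) := @smooth_open_derivable R setT phi a y sphi I.
  by rewrite !deriveN // !mulNr -!mulrN.
have := weak_divergence_le oW (smN _ sP) (smN _ sS) (smN _ sQ) wkN Wx.
rewrite !deriveN; [|exact: smooth_open_derivable sS Wx|exact: smooth_open_derivable sP Wx].
by rewrite -[(- Q) x]/(- Q x) -!opprD oppr_le0.
Qed.

End Codiff.

(** * Killing fields in a chart *)

Lemma ord2_ind (P : 'I_2 -> Prop) : P 0 -> P 1 -> forall a, P a.
Proof.
move=> P0 P1 [[|[|//]] h].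
  by rewrite (_ : Ordinal h = 0) //; exact: val_inj.
by rewrite (_ : Ordinal h = 1) //; exact: val_inj.
Qed.

Lemma sum2 (V : nmodType) (F : 'I_2 -> V) : \sum_(i < 2) F i = F 0 + F 1.
Proof.
rewrite !big_ord_recl big_ord0 addr0; congr (_ + F _); exact: val_inj.
Qed.

Lemma det2 (K : comNzRingType) (A : 'M[K]_2) : \det A = A 0 0 * A 1 1 - A 0 1 * A 1 0.
Proof.
rewrite (expand_det_row _ 0) sum2 /cofactor !det_mx11 !mxE /= expr0 expr1 mul1r mulN1r.
by rewrite mulrN; congr (_ * A _ _ - _ * A _ _); exact: val_inj.
Qed.

Lemma inv2 (K : fieldType) (A : 'M[K]_2) (c d : 'I_2) : \det A != 0 ->
  invmx A c d = (\det A)^-1 * (if c == 0 then (if d == 0 then A 1 1 else - A 0 1)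
                               else (if d == 0 then - A 1 0 else A 0 0)).
Proof.
move=> dA; pose B : 'M[K]_2 := \matrix_(c, d) ((\det A)^-1 *
  (if c == 0 then (if d == 0 then A 1 1 else - A 0 1)
             else (if d == 0 then - A 1 0 else A 0 0))).
have uA : A \in unitmx by rewrite unitmxE unitfE.
have BA : B *m A = 1%:M.
  apply/matrixP => a b; rewrite !mxE sum2 !mxE; move: (dA).
  rewrite (det2 A).
  move: a b; apply: ord2_ind; apply: ord2_ind => /=;
  move: (A 0 0) (A 0 1) (A 1 0) (A 1 1) => p q r s D0;
  rewrite ?mulr1n ?mulr0n; field => //.
have -> : invmx A = B by rewrite -[LHS]mul1mx -BA -mulmxA mulmxV // mulmx1.
by rewrite mxE.
Qed.

Lemma form2 (K : comNzRingType) (G : 'M[K]_2) (u v : 'rV[K]_2) :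
  (u *m G *m v^T) 0 0 = (u 0 0 * G 0 0 + u 0 1 * G 1 0) * v 0 0 +
                        (u 0 0 * G 0 1 + u 0 1 * G 1 1) * v 0 1.
Proof. by rewrite !mxE sum2 !mxE !sum2. Qed.

(** The point comes last, so that a component is a function to which [partial] applies. *)
Definition metric_comp {R : realType} (M : riemannian_surface R) (i : chart M)
  (a b : 'I_2) (x : R * R) : R := metric i x a b.

Section ChartAlgebra.
Context {R : realType} (M : riemannian_surface R) (i : chart M).
Implicit Types (x : R * R) (a b c d : 'I_2) (X : vector_field M).

Local Notation A := (chart_image i).
Local Notation g := (metric_comp i).
Local Notation Gam := (christoffel i).

Lemma chart_image_half_open : half_open A.
Proof. by have [W oW AW] := chart_image_open i; exists W. Qed.
Local Notation hA := chart_image_half_open.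

Lemma metric_symE a b x : A x -> g a b x = g b a x.
Proof. by move=> Ax; rewrite /metric_comp -{1}(Defs.metric_sym Ax) mxE. Qed.

Lemma partial_metric_symE a b c x : A x -> partial a (g b c) x = partial a (g c b) x.
Proof. by move=> Ax; apply: (partial_eq a hA Ax) => y Ay; exact: metric_symE. Qed.

Lemma metric_det_gt0 x : A x -> 0 < \det (metric i x).
Proof.
move=> Ax; rewrite det2.
pose e0 : 'rV[R]_2 := \row_a (if a == 0 then 1 else 0).
have e00 : e0 != 0.
  by apply/eqP => /rowP /(_ 0); rewrite !mxE /= => /eqP; rewrite oner_eq0.
have := Defs.metric_pos Ax e00; rewrite form2 !mxE /=.
rewrite !mul1r !mul0r !addr0 mulr1 mulr0 addr0 => g0.
(* This vector is orthogonal to [e0], and its squared length is g_00 times the determinant. *)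
pose u : 'rV[R]_2 := \row_a (if a == 0 then - g 0 1 x else g 0 0 x).
have u0 : u != 0.
  by apply/eqP => /rowP /(_ 1); rewrite !mxE /= => /eqP; rewrite (gt_eqF g0).
have := Defs.metric_pos Ax u0; rewrite form2 !mxE /=.
rewrite -/(g 0 0 x) -/(g 0 1 x) -/(g 1 0 x) -/(g 1 1 x) (metric_symE 1 0 Ax).
rewrite -/(g 0 0 x) in g0.
move: (g 0 0 x) (g 0 1 x) (g 1 1 x) g0 => p q r p0 H.
have : 0 < p * (p * r - q * q).
  by rewrite (_ : p * _ = (- q * p + p * q) * - q + (- q * q + p * r) * p) //; ring.
by rewrite pmulr_rgt0.
Qed.

Lemma metric_det_neq0 x : A x -> \det (metric i x) != 0.
Proof. by move=> Ax; rewrite gt_eqF // metric_det_gt0. Qed.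

Lemma metric_unit x : A x -> metric i x \in unitmx.
Proof. by move=> Ax; rewrite unitmxE unitfE metric_det_neq0. Qed.

Lemma smooth_metric a b : smooth_on A (g a b).
Proof. exact: metric_smooth. Qed.

Lemma smooth_det : smooth_on A (fun x => \det (metric i x)).
Proof.
apply: (smooth_on_eq (f := fun x => g 0 0 x * g 1 1 x - g 0 1 x * g 1 0 x)).
  by move=> x _; rewrite det2.
by apply: smooth_onB; apply: smooth_onM; exact: smooth_metric.
Qed.

Lemma smooth_invmx c d : smooth_on A (fun x => invmx (metric i x) c d).
Proof.
apply: (smooth_on_eq (f := fun x => (\det (metric i x))^-1 *
   (if c == 0 then (if d == 0 then g 1 1 x else - g 0 1 x)
                               else (if d == 0 then - g 1 0 x else g 0 0 x)))).
  by move=> x Ax; rewrite inv2 // metric_det_neq0.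
apply: smooth_onM; first by apply: smooth_onV; [exact: metric_det_neq0|exact: smooth_det].
by case: (c == 0); case: (d == 0); try apply: smooth_onN; exact: smooth_metric.
Qed.

Lemma smooth_christoffel a b c : smooth_on A (Gam a b c).
Proof.
apply: smooth_onM; first exact: smooth_on_cst.
apply: smooth_on_sum => d; apply: smooth_onM; first exact: smooth_invmx.
by apply: smooth_onB; first apply: smooth_onD; apply: (smooth_on_partial _ hA);
  exact: metric_smooth.
Qed.

Lemma smooth_riemann a b c d : smooth_on A (fun x => riemann i x a b c d).
Proof.
apply: smooth_onD.
  by apply: smooth_onB; apply: (smooth_on_partial _ hA); exact: smooth_christoffel.
apply: smooth_on_sum => e.
by apply: smooth_onB; apply: smooth_onM; exact: smooth_christoffel.
Qed.

Lemma christoffel_sym a b c x : A x -> Gam a b c x = Gam b a c x.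
Proof.
move=> Ax; rewrite /christoffel; congr (_ * _); apply: eq_bigr => d _; congr (_ * _).
rewrite (@partial_metric_symE d a b) //; congr (_ - _); exact: addrC.
Qed.

Lemma christoffel_lower a b d x : A x ->
  Gam a b 0 x * g 0 d x + Gam a b 1 x * g 1 d x =
  2^-1 * (partial a (g b d) x + partial b (g a d) x - partial d (g a b) x).
Proof.
move=> Ax; rewrite /christoffel !sum2.
pose L d := partial a (g b d) x + partial b (g a d) x - partial d (g a b) x.
rewrite -/(L 0) -/(L 1) -/(L d).
have H : metric i x *m invmx (metric i x) = 1%:M by rewrite mulmxV // metric_unit.
have H1 e f : g 0 e x * invmx (metric i x) 0 f + g 1 e x * invmx (metric i x) 1 f = (e == f)%:R.
  move/matrixP: H => /(_ e f); rewrite !mxE sum2 => <-.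
  by rewrite (metric_symE 0 e Ax) (metric_symE 1 e Ax).
have alg (t i00 i01 i10 i11 p q l0 l1 : R) :
    t * (i00 * l0 + i01 * l1) * p + t * (i10 * l0 + i11 * l1) * q =
    t * ((p * i00 + q * i10) * l0 + (p * i01 + q * i11) * l1) by ring.
rewrite alg !H1; congr (_ * _); move: d; apply: ord2_ind => /=.
  by rewrite mul1r mul0r addr0.
by rewrite mul1r mul0r add0r.
Qed.

End ChartAlgebra.

Definition flat_comp {R : realType} {M : riemannian_surface R} (X : vector_field M)
  (i : chart M) (b : 'I_2) (x : R * R) : R := flat X i x 0 b.

Definition curl {R : realType} {M : riemannian_surface R} (X : vector_field M)
  (i : chart M) (x : R * R) : R := curl_comp (flat X i) x.

Definition cov_deriv {R : realType} {M : riemannian_surface R} (X : vector_field M)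
  (i : chart M) (a c : 'I_2) (x : R * R) : R :=
  partial a (fun y => X i y 0 c) x +
  (christoffel i a 0 c x * X i x 0 0 + christoffel i a 1 c x * X i x 0 1).

Definition sqrt_det {R : realType} {M : riemannian_surface R} (i : chart M) (x : R * R) : R :=
  Num.sqrt (\det (metric i x)).

(** R_01bc with the last index lowered. The first pair is fixed at 0, 1, the only independent choice
    in dimension two. *)
Definition riemann_lower {R : realType} {M : riemannian_surface R} (i : chart M)
    (b c : 'I_2) (x : R * R) : R :=
  riemann i x 0 1 b 0 * metric_comp i 0 c x + riemann i x 0 1 b 1 * metric_comp i 1 c x.

(** * Levi-Civita calculus and the Killing equation in components *)

Section KillingAlgebra.
Context {R : realType} (M : riemannian_surface R) (i : chart M).
Implicit Types (x : R * R) (a b c d : 'I_2) (X : vector_field M).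

Local Notation A := (chart_image i).
Local Notation g := (metric_comp i).
Local Notation Gam := (christoffel i).
Local Notation hA := (chart_image_half_open i).

Lemma metric_compat a b c x : A x ->
  partial a (g b c) x = (Gam a b 0 x * g 0 c x + Gam a b 1 x * g 1 c x) +
                        (Gam a c 0 x * g 0 b x + Gam a c 1 x * g 1 b x).
Proof.
move=> Ax; rewrite !christoffel_lower // (partial_metric_symE a c b Ax).
move: (partial _ _ _) (partial _ _ _) (partial _ _ _) => p q r; by field.
Qed.

(** The algebra of Jacobi's formula for the derivative of det g: p, q, r are the metric components
    g_00, g_01, g_11, and the upper index of a Christoffel symbol is the first digit after [G]. *)
Lemma sum4_compat (K : comNzRingType) (p q r G00 G10 G01 G11 : K) :
  ((G00 * p + G10 * q) + (G00 * p + G10 * q)) * r +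
    p * ((G01 * q + G11 * r) + (G01 * q + G11 * r)) -
  (((G00 * q + G10 * r) + (G01 * p + G11 * q)) * q +
    q * ((G01 * p + G11 * q) + (G00 * q + G10 * r)))
  = 2 * (p * r - q * q) * (G00 + G11).
Proof. ring. Qed.

Lemma partial_det a x : A x ->
  partial a (fun y => \det (metric i y)) x =
  2 * \det (metric i x) * (Gam a 0 0 x + Gam a 1 1 x).
Proof.
move=> Ax; have sg := @smooth_metric R M i.
rewrite (partial_eq (g := fun y => g 0 0 y * g 1 1 y - g 0 1 y * g 1 0 y) a hA Ax); last first.
  by move=> y _; rewrite det2.
rewrite (partialB a hA) //; try by apply: smooth_onM.
rewrite !(partialM a hA) // !metric_compat // det2.
rewrite -/(g 0 0 x) -/(g 0 1 x) -/(g 1 0 x) -/(g 1 1 x) (metric_symE 1 0 Ax).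
exact: sum4_compat.
Qed.

Lemma sqrt_det_gt0 x : A x -> 0 < sqrt_det i x.
Proof. by move=> Ax; rewrite sqrtr_gt0 metric_det_gt0. Qed.

Lemma sqrt_detM x : A x -> sqrt_det i x * sqrt_det i x = \det (metric i x).
Proof. by move=> Ax; rewrite -expr2 sqr_sqrtr // ltW // metric_det_gt0. Qed.

Lemma smooth_sqrt_det : smooth_on A (sqrt_det i).
Proof. by apply: smooth_on_sqrt; [exact: metric_det_gt0|exact: smooth_det]. Qed.

(** Obtained by differentiating s s = det g and cancelling 2 s. The trace of the Christoffel symbols
    is what turns d_a (s X^a) into s times the covariant divergence. *)
Lemma partial_sqrt_det a x : A x ->
  partial a (sqrt_det i) x = sqrt_det i x * (Gam a 0 0 x + Gam a 1 1 x).
Proof.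
move=> Ax; have ss := smooth_sqrt_det.
have s0 := sqrt_det_gt0 Ax.
have := partialM a hA ss ss Ax.
rewrite (partial_eq (g := fun y => \det (metric i y)) a hA Ax); last exact: sqrt_detM.
rewrite partial_det // -sqrt_detM //.
move: (partial _ _ _) (sqrt_det i x) s0 (Gam a 0 0 x) (Gam a 1 1 x) => p s s0 G1 G2 E.
apply: (mulfI (x := 2 * s)); first by rewrite mulf_neq0 // gt_eqF.
rewrite (_ : 2 * s * p = p * s + s * p); last by ring.
by rewrite -E; ring.
Qed.

Lemma flat_compE X b x : flat_comp X i b x = X i x 0 0 * g 0 b x + X i x 0 1 * g 1 b x.
Proof. by rewrite /flat_comp /flat !mxE sum2. Qed.

Lemma smooth_vf X c : smooth_on A (fun x => X i x 0 c).
Proof. exact: vf_smooth. Qed.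

Lemma smooth_flat_comp X b : smooth_on A (flat_comp X i b).
Proof.
apply: (smooth_on_eq (f := fun x => X i x 0 0 * g 0 b x + X i x 0 1 * g 1 b x)).
  by move=> x _; rewrite flat_compE.
by apply: smooth_onD; apply: smooth_onM; try exact: smooth_vf; exact: smooth_metric.
Qed.

Lemma smooth_curl X : smooth_on A (curl X i).
Proof.
by apply: smooth_onB; apply: (smooth_on_partial _ hA); exact: smooth_flat_comp.
Qed.

(** Lowering an index commutes with the covariant derivative, by metric compatibility. *)
Lemma partial_flat_comp X a b x : A x ->
  partial a (flat_comp X i b) x =
  Gam a b 0 x * flat_comp X i 0 x + Gam a b 1 x * flat_comp X i 1 x +
  (cov_deriv X i a 0 x * g 0 b x + cov_deriv X i a 1 x * g 1 b x).
Proof.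
move=> Ax; have sg := @smooth_metric R M i; have sX := smooth_vf X.
rewrite (partial_eq (g := fun x => X i x 0 0 * g 0 b x + X i x 0 1 * g 1 b x) a hA Ax); last first.
  by move=> y _; rewrite flat_compE.
rewrite (partialD a hA) //; try by apply: smooth_onM.
rewrite !(partialM a hA) // !metric_compat // !flat_compE /cov_deriv.
rewrite (metric_symE 1 0 Ax).
move: (partial a _ x) (partial a _ x) (X i x 0 0) (X i x 0 1) => p0 p1 x0 x1.
move: (g 0 b x) (g 1 b x) (g 0 0 x) (g 0 1 x) (g 1 1 x) => gb0 gb1 g0 g01 g1.
move: (Gam a 0 0 x) (Gam a 0 1 x) (Gam a 1 0 x) (Gam a 1 1 x) (Gam a b 0 x) (Gam a b 1 x).
move=> *; ring.
Qed.

Lemma killing_cov_deriv X a b x : killing X -> A x ->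
  (cov_deriv X i a 0 x * g 0 b x + cov_deriv X i a 1 x * g 1 b x) +
  (cov_deriv X i b 0 x * g 0 a x + cov_deriv X i b 1 x * g 1 a x) = 0.
Proof.
move=> kX Ax.
pose e a : 'rV[R]_2 := \row_c (c == a)%:R.
have nE a' c : nabla i x (e a') X 0 c = cov_deriv X i a' c x.
  rewrite /cov_deriv !mxE !sum2 !mxE; move: a'; apply: ord2_ind => /=;
    by rewrite mul1r mul0r ?addr0 ?add0r.
have inE' u a' : inner i x u (e a') = u 0 0 * g 0 a' x + u 0 1 * g 1 a' x.
  rewrite /inner form2 !mxE; move: a'; apply: ord2_ind => /=;
    by rewrite mulr1 mulr0 ?addr0 ?add0r.
have inC u v : inner i x u v = inner i x v u.
  rewrite /inner !form2 -/(g 0 0 x) -/(g 0 1 x) -/(g 1 0 x) -/(g 1 1 x) (metric_symE 1 0 Ax).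
  move: (g 0 0 x) (g 0 1 x) (g 1 1 x) => p q r; ring.
by have := kX i x Ax (e a) (e b); rewrite (inC (e a)) !inE' !nE.
Qed.

Lemma killing_flat X a b x : killing X -> A x ->
  partial a (flat_comp X i b) x + partial b (flat_comp X i a) x =
  2 * (Gam a b 0 x * flat_comp X i 0 x + Gam a b 1 x * flat_comp X i 1 x).
Proof.
move=> kX Ax; rewrite !partial_flat_comp //.
rewrite (christoffel_sym b a 0 Ax) (christoffel_sym b a 1 Ax).
have := killing_cov_deriv a b kX Ax.
move: (cov_deriv _ _ _ _ _ * _ + _) (cov_deriv _ _ _ _ _ * _ + _) => p q E.
by rewrite addrACA E addr0 mulr2n mulrDl mul1r.
Qed.

Lemma killing_trace X x : killing X -> A x ->
  cov_deriv X i 0 0 x + cov_deriv X i 1 1 x = 0.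
Proof.
move=> kX Ax; have D0 := metric_det_neq0 Ax.
have E00 := killing_cov_deriv 0 0 kX Ax; have E01 := killing_cov_deriv 0 1 kX Ax.
have E11 := killing_cov_deriv 1 1 kX Ax.
move: D0 E00 E01 E11; rewrite det2 -/(g 0 0 x) -/(g 0 1 x) -/(g 1 0 x) -/(g 1 1 x).
rewrite (metric_symE 1 0 Ax).
move: (g 0 0 x) (g 0 1 x) (g 1 1 x) => p q r.
move: (cov_deriv X i 0 0 x) (cov_deriv X i 0 1 x) (cov_deriv X i 1 0 x) (cov_deriv X i 1 1 x).
move=> n00 n01 n10 n11 D0 E00 E01 E11; apply: (mulfI D0); rewrite mulr0.
have E00' : n00 * p + n01 * q = 0 by lra.
have E11' : n10 * q + n11 * r = 0 by lra.
(* The three Killing equations are contracted with the adjugate of the metric, which avoids its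
   inverse. *)
rewrite (_ : _ * _ = r * (n00 * p + n01 * q) + p * (n10 * q + n11 * r)
   - q * (n00 * q + n01 * r + (n10 * p + n11 * q))); last by ring.
by rewrite E00' E11' E01 !mulr0 addr0 subr0.
Qed.

Definition area_sign a b : R := if a == b then 0 else if a == 0 then 1 else -1.

(** The Killing equation gives the symmetric part of the derivative; the antisymmetric part is half
    the curl by definition. *)
Lemma killing_partial_flat X a b x : killing X -> A x ->
  partial a (flat_comp X i b) x =
  Gam a b 0 x * flat_comp X i 0 x + Gam a b 1 x * flat_comp X i 1 x
    + area_sign a b / 2 * curl X i x.
Proof.
move=> kX Ax.
have K a b := killing_flat a b kX Ax.
have cE : curl X i x = partial 0 (flat_comp X i 1) x - partial 1 (flat_comp X i 0) x by [].
rewrite cE; move: (K 0 0) (K 0 1) (K 1 0) (K 1 1).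
move: a b; apply: ord2_ind; apply: ord2_ind; rewrite /area_sign /=;
move: (partial _ _ _) (partial _ _ _) (partial _ _ _) (partial _ _ _) => p q r s;
move: (Gam 0 0 0 x * _) (Gam 0 0 1 x * _) (Gam 0 1 0 x * _) (Gam 0 1 1 x * _)
  (Gam 1 0 0 x * _) (Gam 1 0 1 x * _) (Gam 1 1 0 x * _) (Gam 1 1 1 x * _) => *; lra.
Qed.

Lemma partial_lin (f1 f2 h1 h2 h : R * R -> R) (k : R) a x : A x ->
  smooth_on A f1 -> smooth_on A f2 -> smooth_on A h1 -> smooth_on A h2 -> smooth_on A h ->
  partial a (fun y => f1 y * h1 y + f2 y * h2 y + k * h y) x =
  partial a f1 x * h1 x + f1 x * partial a h1 x + (partial a f2 x * h2 x + f2 x * partial a h2 x)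
    + k * partial a h x.
Proof.
move=> Ax s1 s2 t1 t2 t; have sk := smooth_on_cst (A := A) k.
rewrite (partialD a hA) //; try by [apply: smooth_onM|apply: smooth_onD; apply: smooth_onM].
rewrite (partialD a hA) //; try by apply: smooth_onM.
by rewrite !(partialM a hA) // partial_cst mul0r add0r.
Qed.

(** Commutes the second derivatives of alpha_b. For given b exactly one of [area_sign 0 b] and
    [area_sign 1 b] is nonzero, so the derivative of w along b stands alone; substituting the
    first-order equations in the other terms produces the curvature and the trace. *)
Lemma partial_curl X b x : killing X -> A x ->
  partial b (curl X i) x = curl X i x * (Gam b 0 0 x + Gam b 1 1 x) +
    2 * (riemann i x 0 1 b 0 * flat_comp X i 0 x + riemann i x 0 1 b 1 * flat_comp X i 1 x).
Proof.
move=> kX Ax.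
have sF := smooth_flat_comp X; have sG := @smooth_christoffel R M i; have sc := smooth_curl X.
have := partial_comm hA (sF b) Ax.
rewrite (partial_eq (g := fun y => Gam 0 b 0 y * flat_comp X i 0 y + Gam 0 b 1 y * flat_comp X i 1 y
    + area_sign 0 b / 2 * curl X i y) 1 hA Ax); last first.
  by move=> y Ay; exact: killing_partial_flat.
rewrite (partial_eq (g := fun y => Gam 1 b 0 y * flat_comp X i 0 y + Gam 1 b 1 y * flat_comp X i 1 y
    + area_sign 1 b / 2 * curl X i y) 0 hA Ax); last first.
  by move=> y Ay; exact: killing_partial_flat.
rewrite !(partial_lin _ _ Ax (sG _ _ _) (sG _ _ _) (sF _) (sF _) sc).
rewrite !(killing_partial_flat _ _ kX Ax) /riemann !sum2.
rewrite (christoffel_sym 1 0 0 Ax) (christoffel_sym 1 0 1 Ax).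
move: b; apply: ord2_ind; rewrite /area_sign /=;
rewrite ?(christoffel_sym 1 0 0 Ax) ?(christoffel_sym 1 0 1 Ax);
move: (flat_comp X i 0 x) (flat_comp X i 1 x) (curl X i x) => u v w;
move: (partial 0 (curl X i) x) (partial 1 (curl X i) x) => w0 w1;
move: (partial 0 _ x) (partial 0 _ x) (partial 1 _ x) (partial 1 _ x) => p q r s;
move: (Gam 0 0 0 x) (Gam 0 0 1 x) (Gam 0 1 0 x) (Gam 0 1 1 x) (Gam 1 1 0 x) (Gam 1 1 1 x);
move=> G1 G2 G3 G4 G5 G6; lra.
Qed.

End KillingAlgebra.

(** * Curvature *)

(** K = g(R(e_0, e_1) e_1, e_0) / det g, computed chart by chart; agreement between charts is
    established at the end, from the two vector fields. *)
Definition gauss_curvature {R : realType} {M : riemannian_surface R} (i : chart M)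
  (x : R * R) : R := riemann_lower i 1 0 x / \det (metric i x).

Section Curvature.
Context {R : realType} (M : riemannian_surface R) (i : chart M).
Implicit Types (x : R * R) (a b c d : 'I_2) (X : vector_field M) (u v : 'rV[R]_2).

Local Notation A := (chart_image i).
Local Notation g := (metric_comp i).
Local Notation Gam := (christoffel i).
Local Notation hA := (chart_image_half_open i).

Lemma partial_sum4 (f1 f2 f3 f4 h1 h2 h3 h4 : R * R -> R) a x : A x ->
  smooth_on A f1 -> smooth_on A f2 -> smooth_on A f3 -> smooth_on A f4 ->
  smooth_on A h1 -> smooth_on A h2 -> smooth_on A h3 -> smooth_on A h4 ->
  partial a (fun y => (f1 y * h1 y + f2 y * h2 y) + (f3 y * h3 y + f4 y * h4 y)) x =
  (partial a f1 x * h1 x + f1 x * partial a h1 x +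
    (partial a f2 x * h2 x + f2 x * partial a h2 x)) +
  (partial a f3 x * h3 x + f3 x * partial a h3 x +
    (partial a f4 x * h4 x + f4 x * partial a h4 x)).
Proof.
move=> Ax s1 s2 s3 s4 t1 t2 t3 t4.
rewrite (partialD a hA) //; try by apply: smooth_onD; apply: smooth_onM.
rewrite !(partialD a hA) //; try by apply: smooth_onM.
by rewrite !(partialM a hA).
Qed.

(** Commuting the second derivatives of g_bc and inserting metric compatibility twice: the curvature
    operator annihilates the metric. *)
Lemma riemann_lower_anti b c x : A x ->
  riemann_lower i b c x + riemann_lower i c b x = 0.
Proof.
move=> Ax; have sg := @smooth_metric R M i; have sG := @smooth_christoffel R M i.
have := partial_comm hA (sg b c) Ax.
pose S a b c y := (Gam a b 0 y * g 0 c y + Gam a b 1 y * g 1 c y) +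
                        (Gam a c 0 y * g 0 b y + Gam a c 1 y * g 1 b y).
rewrite (partial_eq (g := S 0 b c) 1 hA Ax); last by move=> y Ay; exact: metric_compat.
rewrite (partial_eq (g := S 1 b c) 0 hA Ax); last by move=> y Ay; exact: metric_compat.
rewrite !partial_sum4 // !metric_compat // /riemann_lower /riemann !sum2.
rewrite !(metric_symE 1 0 Ax).
move: b c {S}; apply: ord2_ind; apply: ord2_ind; rewrite ?(metric_symE 1 0 Ax);
move: (g 0 0 x) (g 0 1 x) (g 1 1 x) => p q r;
move: (Gam 0 0 0 x) (Gam 0 0 1 x) (Gam 0 1 0 x) (Gam 0 1 1 x)
  (Gam 1 0 0 x) (Gam 1 0 1 x) (Gam 1 1 0 x) (Gam 1 1 1 x) => G1 G2 G3 G4 G5 G6 G7 G8;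
move: (partial 1 (Gam 0 0 0) x) (partial 1 (Gam 0 0 1) x) (partial 1 (Gam 0 1 0) x)
  (partial 1 (Gam 0 1 1) x) (partial 0 (Gam 1 0 0) x) (partial 0 (Gam 1 0 1) x)
  (partial 0 (Gam 1 1 0) x) (partial 0 (Gam 1 1 1) x) => P1 P2 P3 P4 P5 P6 P7 P8; lra.
Qed.

Lemma riemann_lower_diag b x : A x -> riemann_lower i b b x = 0.
Proof.
by move=> Ax; have := riemann_lower_anti b b Ax; move: (riemann_lower _ _ _ _) => p; lra.
Qed.

Lemma riemann_anti a b c d x : riemann i x a b c d = - riemann i x b a c d.
Proof.
rewrite /riemann !sum2; move: (partial _ _ _) (partial _ _ _) => p q.
move: (Gam a 0 d x) (Gam a 1 d x) (Gam b 0 d x) (Gam b 1 d x) => *.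
ring.
Qed.

Lemma riemann_diag a c d x : riemann i x a a c d = 0.
Proof. by have := riemann_anti a a c d x; move: (riemann _ _ _ _ _ _) => p; lra. Qed.

Lemma smooth_riemann_lower b c : smooth_on A (riemann_lower i b c).
Proof.
by apply: smooth_onD; apply: smooth_onM; try exact: smooth_riemann; exact: smooth_metric.
Qed.

Lemma smooth_gauss_curvature : smooth_on A (gauss_curvature i).
Proof.
apply: smooth_onM; first exact: smooth_riemann_lower.
by apply: smooth_onV; [exact: metric_det_neq0|exact: smooth_det].
Qed.

Lemma sectional_curvatureE x u v : A x -> row_free (col_mx u v) ->
  sectional_curvature i x u v = gauss_curvature i x.
Proof.
move=> Ax free.
have w0 : u 0 0 * v 0 1 - u 0 1 * v 0 0 != 0.
  move: free; rewrite row_free_unit (unitmxE (col_mx u v : 'M[R]_2)) unitfE det2.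
  have E0 c : (col_mx u v : 'M[R]_2) 0 c = u 0 c.
    rewrite -[RHS](col_mxEu u v); congr (col_mx u v _ _); exact: val_inj.
  have E1 c : (col_mx u v : 'M[R]_2) 1 c = v 0 c.
    rewrite -[RHS](col_mxEd u v); congr (col_mx u v _ _); exact: val_inj.
  by rewrite !E0 !E1.
have D0 := metric_det_neq0 Ax.
have cE d : curvature i x u v v 0 d = (u 0 0 * v 0 1 - u 0 1 * v 0 0) *
   (v 0 0 * riemann i x 0 1 0 d + v 0 1 * riemann i x 0 1 1 d).
  rewrite !mxE !sum2 !riemann_diag (riemann_anti 1 0 0) (riemann_anti 1 0 1).
  move: (riemann _ _ _ _ _ _) (riemann _ _ _ _ _ _) => p q; ring.
have r00 := riemann_lower_diag 0 Ax; have r11 := riemann_lower_diag 1 Ax.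
have r01 := riemann_lower_anti 0 1 Ax.
rewrite /sectional_curvature /gauss_curvature /inner !form2 !cE.
rewrite -/(g 0 0 x) -/(g 0 1 x) -/(g 1 0 x) -/(g 1 1 x).
move: D0; rewrite det2 -/(g 0 0 x) -/(g 0 1 x) -/(g 1 0 x) -/(g 1 1 x).
move: r00 r11 r01; rewrite /riemann_lower !(metric_symE 1 0 Ax).
move: (riemann i x 0 1 0 0) (riemann i x 0 1 0 1)
  (riemann i x 0 1 1 0) (riemann i x 0 1 1 1) => R1 R2 R3 R4.
move: (g 0 0 x) (g 0 1 x) (g 1 1 x) w0 => p q r.
move: (u 0 0) (u 0 1) (v 0 0) (v 0 1) => u0 u1 v0 v1 w0 r00 r11 r01 D0.
(* Numerator and denominator both carry the square of the minor t = u_0 v_1 - u_1 v_0, which linear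
   independence makes nonzero. *)
have ratio (n m t k D : R) : t != 0 -> n = t ^+ 2 * k -> m = t ^+ 2 * D -> n / m = k / D.
  by move=> t0 -> ->; rewrite invfM mulrACA mulfV ?mul1r // expf_neq0.
apply: (ratio _ _ _ _ _ w0); last by ring.
(* Grouped so that antisymmetry of the lowered curvature removes everything except the minor times
   R_0110. *)
transitivity ((u0 * v1 - u1 * v0) *
     (v0 * u0 * (R1 * p + R2 * q) + v1 * u1 * (R3 * q + R4 * r) +
      v0 * u1 * ((R1 * q + R2 * r) + (R3 * p + R4 * q)) +
      (u0 * v1 - u1 * v0) * (R3 * p + R4 * q))); first by ring.
by rewrite r00 r11 r01; ring.
Qed.

Lemma curl_flat_sum X b x : A x ->
  riemann i x 0 1 b 0 * flat_comp X i 0 x + riemann i x 0 1 b 1 * flat_comp X i 1 x =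
  riemann_lower i b 0 x * X i x 0 0 + riemann_lower i b 1 x * X i x 0 1.
Proof.
move=> Ax; rewrite !flat_compE /riemann_lower (metric_symE 1 0 Ax).
move: (riemann _ _ _ _ _ _) (riemann _ _ _ _ _ _) (g 0 0 x) (g 0 1 x) (g 1 1 x).
move: (X i x 0 0) (X i x 0 1) => *.
ring.
Qed.

(** The Hodge star of dX^flat, up to orientation. Division by s removes the trace term of
    [partial_curl]. *)
Definition curl_density X x : R := curl X i x * (sqrt_det i x)^-1.

Lemma smooth_sqrt_detV : smooth_on A (fun x => (sqrt_det i x)^-1).
Proof.
apply: smooth_onV; last exact: smooth_sqrt_det.
by move=> x Ax; rewrite gt_eqF // sqrt_det_gt0.
Qed.

Lemma smooth_curl_density X : smooth_on A (curl_density X).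
Proof. by apply: smooth_onM; [exact: smooth_curl|exact: smooth_sqrt_detV]. Qed.

(** The product rho s = w is differentiated instead of a quotient; the trace terms from w and from s
    cancel. *)
Lemma partial_curl_density X b x : killing X -> A x ->
  sqrt_det i x * partial b (curl_density X) x =
    2 * (riemann_lower i b 0 x * X i x 0 0 + riemann_lower i b 1 x * X i x 0 1).
Proof.
move=> kX Ax; rewrite -curl_flat_sum //.
have s0 := sqrt_det_gt0 Ax.
have := partialM b hA (smooth_curl_density X) (@smooth_sqrt_det R M i) Ax.
rewrite (partial_eq (g := curl X i) b hA Ax); last first.
  by move=> y Ay; rewrite /curl_density mulfVK // gt_eqF // sqrt_det_gt0.
rewrite partial_curl // partial_sqrt_det // /curl_density.
move: (partial b _ x) (riemann _ _ _ _ _ _ * _ + _) (sqrt_det i x) s0 (curl X i x)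
  (Gam b 0 0 x + Gam b 1 1 x).
move=> p q s s0 w t; rewrite mulrA mulfVK ?gt_eqF // => E.
by rewrite mulrC; apply: (addrI (w * t)); rewrite E addrC.
Qed.

End Curvature.

(** * The Hodge Laplacian of a Killing field *)

Section Hodge.
Context {R : realType} (M : riemannian_surface R) (i : chart M).
Implicit Types (x : R * R) (a b c d : 'I_2) (X LX : vector_field M).

Local Notation A := (chart_image i).
Local Notation g := (metric_comp i).
Local Notation Gam := (christoffel i).
Local Notation hA := (chart_image_half_open i).

Lemma chart_interior_half_open : half_open A°.
Proof.
exists A°; first exact: open_interior.
apply/seteqP; split=> [x Ax|x []//]; split=> //.
have [W _ AW] := chart_image_open i.
by have : A x by [exact: interior_subset]; rewrite /chart_image AW => -[].
Qed.

Lemma smooth_on_interior h : smooth_on A h -> smooth_open A° h.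
Proof.
by move=> sh; apply: smooth_on_open sh _ _; [exact: open_interior|exact: interior_subset].
Qed.

Lemma derive_interior h a x : smooth_on A h -> A° x ->
  'D_(basis_vec R a) h x = partial a h x.
Proof.
move=> sh Ax; rewrite partial_derive //.
exact: smooth_open_derivable (smooth_on_interior sh) Ax.
Qed.

Lemma weak_divergence_chart P S Q x : smooth_on A P -> smooth_on A S -> smooth_on A Q ->
  weak_divergence A° P S Q -> A° x -> Q x = - (partial 0 P x + partial 1 S x).
Proof.
move=> sP sS sQ wk Ax.
rewrite (weak_divergenceE (open_interior _) (smooth_on_interior sP)
  (smooth_on_interior sS) (smooth_on_interior sQ) wk Ax).
by rewrite !derive_interior.
Qed.

Lemma inner_1forms_flat X x (alpha : 'rV[R]_2) : A x ->
  inner_1forms i x alpha (flat X i x) = alpha 0 0 * X i x 0 0 + alpha 0 1 * X i x 0 1.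
Proof.
move=> Ax; rewrite /inner_1forms /flat trmx_mul (Defs.metric_sym Ax) mulmxA mulmxKV ?metric_unit //.
by rewrite !mxE sum2 !mxE.
Qed.

Lemma partial_test phi a x : smooth_open setT phi ->
  partial a phi x = 'D_(basis_vec R a) phi x.
Proof. by move=> sphi; apply: partial_derive; exact: smooth_open_derivable sphi I. Qed.

(** The weak identity gives s f = - d_a (s X^a). The derivative of s turns the right-hand side into
    - s times the trace of nabla X, which is zero for a Killing field. *)
Lemma codiff_killing X f x : killing X -> smooth_function f ->
  is_codiff_1form (flat X) f -> A° x -> f (chart_inv i x) = 0.
Proof.
move=> kX sf cf Aox; have Ax := interior_subset Aox.
have ss := @smooth_sqrt_det R M i; have sX := @smooth_vf R M i X.
have wk : weak_divergence A° (fun x => sqrt_det i x * X i x 0 0)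
    (fun x => sqrt_det i x * X i x 0 1) (fun x => f (chart_inv i x) * sqrt_det i x).
  move=> phi sphi tphi; have := cf i phi (conj sphi tphi); rewrite /chart_integral => E.
  transitivity (\int[(lebesgue_measure \x lebesgue_measure)%E]_(y in A°)
    (inner_1forms i y (grad_comp phi y) (flat X i y) * Num.sqrt (\det (metric i y)))).
    apply: eq_Rintegral => y /set_mem Aoy.
    rewrite inner_1forms_flat ?mxE; last exact: interior_subset.
    rewrite !partial_test // -/(sqrt_det i y).
    move: (sqrt_det i y) ('D_(basis_vec R 0) phi y) ('D_(basis_vec R 1) phi y).
    move: (X i y 0 0) (X i y 0 1) => *; ring.
  by rewrite E; apply: eq_Rintegral => y _; rewrite mulrA.
have sfi : smooth_on A (fun x => f (chart_inv i x)) by exact: sf.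
have := weak_divergence_chart (smooth_onM ss (sX 0)) (smooth_onM ss (sX 1))
  (smooth_onM sfi ss) wk Aox.
rewrite !(partialM _ hA) // !partial_sqrt_det //.
have := killing_trace kX Ax.
rewrite /cov_deriv (christoffel_sym 1 0 1 Ax) (christoffel_sym 1 0 0 Ax).
have := sqrt_det_gt0 Ax.
move: (partial 0 _ x) (partial 1 _ x) (X i x 0 0) (X i x 0 1) (sqrt_det i x) (f (chart_inv i x)).
move: (Gam 0 0 0 x) (Gam 0 0 1 x) (Gam 0 1 0 x) (Gam 0 1 1 x) (Gam 1 1 1 x).
move=> G1 G2 G3 G4 G5 p q X0 X1 s F s0 tr E.
apply: (mulIf (x := s)); first by rewrite gt_eqF.
rewrite mul0r E.
rewrite (_ : s * (G1 + G4) * X0 + s * p + (s * (G3 + G5) * X1 + s * q) =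
  s * (p + (G1 * X0 + G3 * X1) + (q + (G4 * X0 + G5 * X1)))); last by ring.
by rewrite tr mulr0 oppr0.
Qed.

(** Testing with eta = phi dx^c isolates the contravariant component c of theta, and d eta involves
    only the derivative of phi along the other coordinate. *)
Lemma codiff_form X (theta : one_form M) (c : 'I_2) x :
  is_codiff_2form (fun i => curl_comp (flat X i)) theta -> A° x ->
  sqrt_det i x * sharp i x (theta i x) 0 c =
    area_sign c (other c) * partial (other c) (curl_density i X) x.
Proof.
move=> ct Aox; have Ax := interior_subset Aox.
have ss := @smooth_sqrt_det R M i.
have sth a : smooth_on A (fun x => theta i x 0 a) by exact: of_smooth.
have srho := @smooth_curl_density R M i X.
have sE y : sharp i y (theta i y) 0 c =
    theta i y 0 0 * invmx (metric i y) 0 c + theta i y 0 1 * invmx (metric i y) 1 c.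
  by rewrite /sharp !mxE sum2.
pose Q y := sqrt_det i y *
  (theta i y 0 0 * invmx (metric i y) 0 c + theta i y 0 1 * invmx (metric i y) 1 c).
have sQ : smooth_on A Q.
  apply: smooth_onM => //; apply: smooth_onD; apply: smooth_onM => //; exact: smooth_invmx.
have s0 := smooth_on_cst (A := A) (0 : R).
(* The coefficient of d(phi dx^c) is - d_1 phi for c = 0 and d_0 phi for c = 1, which dictates P and
   S; the factors 1 / det g and s combine with w into rho. *)
pose P y := if c == 0 then 0 else curl_density i X y.
pose S y := if c == 0 then - curl_density i X y else 0.
have sP : smooth_on A P by rewrite /P; case: (c == 0).
have sS : smooth_on A S by rewrite /S; case: (c == 0) => //; exact: smooth_onN.
have wk : weak_divergence A° P S Q.
  move=> phi sphi tphi.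
  pose eta y : 'rV[R]_2 := \row_a (if a == c then phi y else 0).
  have teta a : test_function i (fun y => eta y 0 a).
    have -> : (fun y => eta y 0 a) = if a == c then phi else (fun=> 0).
      by apply/funext => y; rewrite mxE; case: (a == c).
    case: (a == c); first exact: (conj sphi tphi).
    split; first by move=> k; exact: class_C_cst.
    by have [C cC [CA _]] := tphi; exists C.
  have := ct i eta teta; rewrite /chart_integral => E.
  transitivity (\int[(lebesgue_measure \x lebesgue_measure)%E]_(y in A°)
    (inner_2forms i y (curl_comp eta y) (curl_comp (flat X i) y) * Num.sqrt (\det (metric i y)))).
    apply: eq_Rintegral => y /set_mem /interior_subset Ay.
    have cE : curl_comp eta y =
        if c == 0 then - 'D_(basis_vec R 1) phi y else 'D_(basis_vec R 0) phi y.
      have eE a : (fun y => eta y 0 a) = if a == c then phi else (fun=> 0).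
        by apply/funext => z; rewrite mxE; case: (a == c).
      rewrite /curl_comp !eE -!partial_test //; move: (c); apply: ord2_ind => /=;
        by rewrite partial_cst ?sub0r ?subr0.
    rewrite cE /inner_2forms -/(curl X i y) -/(sqrt_det i y) /P /S /curl_density.
    rewrite -(sqrt_detM Ay).
    have := sqrt_det_gt0 Ay; move: (sqrt_det i y) (curl X i y).
    move: ('D_(basis_vec R 0) phi y) ('D_(basis_vec R 1) phi y).
    move=> d0 d1 s w /gt_eqF sn0.
    by case: (c == 0); field; rewrite sn0.
  rewrite E; apply: eq_Rintegral => y /set_mem /interior_subset Ay.
  rewrite /Q -/(sqrt_det i y) /inner_1forms form2 !mxE.
  have Is a : invmx (metric i y) a c = invmx (metric i y) c a.
    by rewrite -{1}(Defs.metric_sym Ay) -trmx_inv mxE.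
  rewrite !Is; move: (sqrt_det i y) (phi y) (theta i y 0 0) (theta i y 0 1) => s p t0 t1.
  move: (c); apply: ord2_ind => /=;
  move: (invmx _ 0 0) (invmx _ 0 1) (invmx _ 1 0) (invmx _ 1 1) => *; ring.
rewrite sE -/(Q x) (weak_divergence_chart sP sS sQ wk Aox) /P /S.
move: (c); apply: ord2_ind; rewrite /area_sign /other /=.
  by rewrite partial_cst add0r (partialN _ hA) // opprK mul1r.
by rewrite partial_cst addr0 mulN1r.
Qed.

(** Since f vanishes on the open interior, so does its gradient, and only delta d remains. It
    contributes the derivative of rho along the index other than c, and there antisymmetry of the
    curvature keeps only the component c of X. *)
Lemma hodge_laplacian_interior X LX x c : killing X -> is_hodge_laplacian X LX -> A° x ->
  LX i x 0 c = 2 * gauss_curvature i x * X i x 0 c.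
Proof.
move=> kX [f [theta [sf cf ct LXE]]] Aox; have Ax := interior_subset Aox.
have -> : LX i x = sharp i x (theta i x).
  rewrite (LXE i x Ax); congr sharp; rewrite -[RHS]add0r; congr (_ + _).
  apply/rowP => a; rewrite !mxE.
  rewrite (partial_eq (g := fun=> 0) a chart_interior_half_open Aox) ?partial_cst //.
  by move=> y Ay; exact: codiff_killing cf Ay.
have s0 := sqrt_det_gt0 Ax.
have E := codiff_form c ct Aox.
have F := partial_curl_density (other c) kX Ax.
have r00 := riemann_lower_diag 0 Ax; have r11 := riemann_lower_diag 1 Ax.
have r01 := riemann_lower_anti 0 1 Ax.
rewrite /gauss_curvature -(sqrt_detM Ax).
move: E F; move: (sharp _ _ _ _ _) => l.
move: c; apply: ord2_ind; rewrite /area_sign /other /= ?mul1r ?mulN1r;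
move: r00 r11 r01; move: (riemann_lower i 0 0 x) (riemann_lower i 0 1 x)
  (riemann_lower i 1 0 x) (riemann_lower i 1 1 x);
move=> r00 r01 r10 r11 h00 h11 /eqP; rewrite addr_eq0 => /eqP h01; rewrite ?h00 ?h11 ?h01;
move: (partial _ _ _) (sqrt_det i x) s0 (X i x 0 0) (X i x 0 1) => p s s0 X0 X1 E F;
have sn0 : s != 0 by rewrite gt_eqF.
- apply: (mulfI (mulf_neq0 sn0 sn0)).
  by rewrite -mulrA E F; field.
- apply: (mulfI (mulf_neq0 sn0 sn0)).
  by rewrite -mulrA E mulrN F; field.
Qed.

End Hodge.

(** * Behaviour up to the boundary *)

Section HalfOpen.
Context {R : realType}.
Implicit Types (h : R * R -> R) (A V U : set (R * R)) (x y : R * R).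

(** A small move along the second basis vector leaves the boundary line but not A. *)
Lemma half_open_dense A V x : half_open A -> A x -> open V -> V x ->
  exists y, [/\ V y, A y & 0 < y.2].
Proof.
move=> hA Ax oV Vx.
have nA := half_open_near 1 hA Ax.
have nV := near_line_right (basis_vec R 1) oV Vx.
have Hx : 0 <= x.2 by case: hA => W _ AW; move: Ax; rewrite AW => -[].
suff : exists t : R, [/\ 0 < t, A (x + t *: basis_vec R 1) & V (x + t *: basis_vec R 1)].
  move=> [t [t0 At Vt]]; exists (x + t *: basis_vec R 1); split=> //.
  by rewrite /basis_vec /= [_ *: 1]mulr1; exact: ltr_wpDl.
have : \forall t \near (0 : R)^'+,
    [/\ 0 < t, A (x + t *: basis_vec R 1) & V (x + t *: basis_vec R 1)].
  near=> t; split; near: t; [exact: nbhs_right_gt|exact: nA|exact: nV].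
by move=> /filter_ex.
Unshelve. all: by end_near. Qed.

Lemma smooth_on_near A h x : smooth_on A h -> A x -> forall P : set R, open P -> P (h x) ->
  exists U, [/\ open U, U x & forall y, A y -> U y -> P (h y)].
Proof.
move=> sh Ax P oP Px; have [W [F [oW Wx sF Fh]]] := sh x Ax.
have nF : nbhs x (F @^-1` P).
  by apply: (smooth_open_continuous sF Wx); apply: open_nbhs_nbhs; split=> //; rewrite Fh.
have [U [oU Ux UP]] := nbhs_open nF.
exists (U `&` W); split; [exact: openI|by []|].
by move=> y Ay [Uy Wy]; rewrite -Fh //; exact: UP.
Qed.

Lemma half_open_ext A h : half_open A -> smooth_on A h ->
  (forall x, A x -> 0 < x.2 -> h x = 0) -> forall x, A x -> h x = 0.
Proof.
move=> hA sh h0 x Ax; apply/eqP/negPn/negP => hx.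
have [U [oU Ux Uh]] := smooth_on_near sh Ax (P := [set z | z != 0]) (@open_neq _ _) hx.
have [y [Uy Ay y0]] := half_open_dense hA Ax oU Ux.
by have := Uh y Ay Uy; rewrite /= h0 // eqxx.
Qed.

Lemma half_open_rect A V x : half_open A -> A x -> open V -> V x ->
  exists u1 v1 u2 v2, [/\ rect u1 v1 u2 v2 x, rect u1 v1 u2 v2 `<=` V &
    forall y, rect u1 v1 u2 v2 y -> 0 <= y.2 -> A y].
Proof.
move=> [W oW AW] + oV Vx; rewrite AW => -[Wx Hx].
have : nbhs x (W `&` V) by apply: open_nbhs_nbhs; split=> //; exact: openI.
move=> /nbhs_ballP[r /= r0 rWV].
have rb y : rect (x.1 - r) (x.1 + r) (x.2 - r) (x.2 + r) y -> ball x r y.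
  by rewrite /rect /= !in_itv /= => -[h1 h2]; split; rewrite /ball /= ltr_norml; lra.
exists (x.1 - r), (x.1 + r), (x.2 - r), (x.2 + r); split.
- by rewrite /rect /= !in_itv /=; split; lra.
- by move=> y /rb/rWV[].
- by move=> y /rb/rWV[Wy _] y0; split.
Qed.

Lemma half_open_setI A V : half_open A -> open V -> half_open (A `&` V).
Proof.
move=> [W oW ->] oV; exists (W `&` V); first exact: openI.
by rewrite setIAC.
Qed.

(** The part of a rectangle above the boundary line is again an open rectangle, so [gronwall_rect]
    applies to it. *)
Lemma rect_upper u1 v1 u2 v2 x : rect u1 v1 (Num.max 0 u2) v2 x <->
  rect u1 v1 u2 v2 x /\ 0 < x.2.
Proof.
rewrite /rect /= !in_itv /= gt_max; split; first by move=> [-> /andP[/andP[-> ->] ->]].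
by move=> [[-> /andP[-> ->]] ->].
Qed.

(* On a rectangle meeting the half-plane, an estimate on the open upper part
   extends to the boundary line by continuity. *)
Lemma half_open_gronwall A f (c : R) u1 v1 u2 v2 q : half_open A -> smooth_on A f ->
  (forall y, rect u1 v1 u2 v2 y -> 0 <= y.2 -> A y) ->
  (forall x, A x -> 0 <= f x) ->
  (forall a x, A x -> rect u1 v1 u2 v2 x -> `|partial a f x| <= c * f x) ->
  A q -> rect u1 v1 u2 v2 q -> 0 < q.2 -> f q = 0 ->
  forall x, A x -> rect u1 v1 u2 v2 x -> f x = 0.
Proof.
move=> hA sf rA f0 fb Aq rq q0 fq.
have rA' x : rect u1 v1 (Num.max 0 u2) v2 x -> A x.
  by move=> /rect_upper[rx x0]; apply: rA => //; exact: ltW.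
have sf' : smooth_open (rect u1 v1 (Num.max 0 u2) v2) f.
  by apply: (smooth_on_open sf) => //; exact: rect_open.
have f0' x : rect u1 v1 (Num.max 0 u2) v2 x -> f x = 0.
  apply: (@gronwall_rect _ _ _ _ _ f c q sf') => //.
  - by move=> y /rA'; exact: f0.
  - move=> a y ry; rewrite -partial_derive; last exact: smooth_open_derivable sf' ry.
    by apply: fb; [exact: rA'|have [] := (rect_upper u1 v1 u2 v2 y).1 ry].
  - exact/rect_upper.
have hAr := half_open_setI hA (@rect_open R u1 v1 u2 v2).
have sfr : smooth_on (A `&` rect u1 v1 u2 v2) f by apply: smooth_on_subset sf => y [].
have H := half_open_ext hAr sfr.
move=> x Ax rx; apply: H => // y [Ay ry] y0; apply: f0'; exact/rect_upper.
Qed.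

(** Gronwall with constant 0 for the square of f - f(q), where q lies off the boundary line because
    the estimate must start there; x itself may be a boundary point. *)
Lemma half_open_constant A f x : half_open A -> smooth_on A f -> A x ->
  (forall a y, A y -> partial a f y = 0) ->
  exists B, [/\ open B, B x & forall y, A y -> B y -> f y = f x].
Proof.
move=> hA sf Ax df.
have [u1 [v1 [u2 [v2 [rx _ rA]]]]] := half_open_rect hA Ax openT I.
exists (rect u1 v1 u2 v2); split=> //; first exact: rect_open.
have [q [rq Aq q0]] := half_open_dense hA Ax (@rect_open R u1 v1 u2 v2) rx.
pose h y := (f y - f q) * (f y - f q).
have sfq : smooth_on A (fun y => f y - f q) by apply: smooth_onB => //; exact: smooth_on_cst.
have dfq a y : A y -> partial a (fun y => f y - f q) y = 0.
  move=> Ay; rewrite (partialB a hA sf (smooth_on_cst _) Ay) partial_cst df //.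
  exact: subr0.
have h0 y : A y -> rect u1 v1 u2 v2 y -> h y = 0.
  apply: (@half_open_gronwall A h 0 u1 v1 u2 v2 q) => //.
  - exact: smooth_onM.
  - by move=> z _; rewrite /h -expr2 sqr_ge0.
  - by move=> a z Az _; rewrite (partialM a hA) // dfq // mulr0 mul0r addr0 normr0 mul0r.
  - by rewrite /h subrr mulr0.
have fE y : A y -> rect u1 v1 u2 v2 y -> f y = f q.
  by move=> Ay ry; have := h0 y Ay ry => /eqP; rewrite mulf_eq0 orbb subr_eq0 => /eqP.
by move=> y Ay ry; rewrite !fE.
Qed.

End HalfOpen.

(** * The Laplacian and the gradient of the curvature up to the boundary *)

Section LocalKilling.
Context {R : realType} (M : riemannian_surface R) (i : chart M).
Implicit Types (x : R * R) (a b c d : 'I_2) (X LX : vector_field M).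

Local Notation A := (chart_image i).
Local Notation g := (metric_comp i).
Local Notation Gam := (christoffel i).
Local Notation hA := (chart_image_half_open i).

Lemma chart_interior_upper x : A x -> 0 < x.2 -> A° x.
Proof.
move=> Ax x0; have [W oW AW] := chart_image_open i.
have oU : open (W `&` [set y : R * R | 0 < y.2]).
  apply: openI => //; apply: (open_comp (f := snd) (D := [set z : R | 0 < z])); last exact: open_gt.
  by move=> y _; exact: cvg_snd.
have Wx : W x by move: Ax; rewrite /chart_image AW => -[].
have : nbhs x (W `&` [set y : R * R | 0 < y.2]) by apply: open_nbhs_nbhs; split.
by apply: filterS => y [Wy /ltW y0]; rewrite /chart_image AW; split.
Qed.

Lemma hodge_laplacian_killing X LX x : killing X -> is_hodge_laplacian X LX -> A x ->
  LX i x = (2 * gauss_curvature i x) *: X i x.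
Proof.
move=> kX hL Ax; apply/rowP => c; rewrite mxE; apply/eqP; rewrite -subr_eq0; apply/eqP.
have sh : smooth_on A (fun x => LX i x 0 c - 2 * gauss_curvature i x * X i x 0 c).
  apply: smooth_onB; first exact: smooth_vf.
  apply: smooth_onM; last exact: smooth_vf.
  by apply: smooth_onM; [exact: smooth_on_cst|exact: smooth_gauss_curvature].
apply: (half_open_ext hA sh) => // y Ay y0.
by rewrite (hodge_laplacian_interior c kX hL (chart_interior_upper Ay y0)) subrr.
Qed.

Lemma flat_comp_eq0 X x : A x -> flat_comp X i 0 x = 0 -> flat_comp X i 1 x = 0 -> X i x = 0.
Proof.
move=> Ax f0 f1.
have f : flat X i x = 0.
  by apply/rowP; apply: ord2_ind; rewrite [RHS]mxE; [exact: f0|exact: f1].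
by rewrite -[LHS](mulmxK (metric_unit Ax)) -/(flat X i x) f mul0mx.
Qed.

(** Subtracting 2 K times the Killing equation of X from that of LX leaves a vanishing symmetric
    product of dK and alpha. A nonzero component of alpha then forces both components of dK to
    vanish. *)
Lemma partial_gauss_curvature X LX a x : killing X -> killing LX -> is_hodge_laplacian X LX ->
  A x -> X i x != 0 -> partial a (gauss_curvature i) x = 0.
Proof.
move=> kX kL hL Ax X0.
have sK := @smooth_gauss_curvature R M i; have sF := @smooth_flat_comp R M i X.
have fE b y : A y -> flat_comp LX i b y = 2 * (gauss_curvature i y * flat_comp X i b y).
  move=> Ay; rewrite !flat_compE (hodge_laplacian_killing kX hL Ay) !mxE.
  move: (gauss_curvature i y) => K; ring.
have pE a' b : partial a' (flat_comp LX i b) x =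
    2 * (partial a' (gauss_curvature i) x * flat_comp X i b x
    + gauss_curvature i x * partial a' (flat_comp X i b) x).
  rewrite (partial_eq (g := fun y => 2 * (gauss_curvature i y * flat_comp X i b y)) a' hA Ax);
    last first.
    by move=> y Ay; exact: fE.
  rewrite (partialM a' hA (smooth_on_cst (A := A) 2) (smooth_onM sK (sF b)) Ax).
  by rewrite partial_cst mul0r add0r (partialM a' hA).
have E a' b : partial a' (gauss_curvature i) x * flat_comp X i b x +
              partial b (gauss_curvature i) x * flat_comp X i a' x = 0.
  have := killing_flat a' b kL Ax; rewrite !pE !fE //.
  have := killing_flat a' b kX Ax.
  move: (partial _ _ _) (partial _ _ _) (partial _ _ _) (partial _ _ _) => p q r s.
  move: (gauss_curvature i x) (Gam a' b 0 x) (Gam a' b 1 x) (flat_comp X i 0 x) (flat_comp X i 1 x).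
  move=> K G0 G1 f0 f1; move: (flat_comp X i b x) (flat_comp X i a' x) => u v H1 H2.
  have H3 : K * (s + r) = K * (2 * (G0 * f0 + G1 * f1)) by rewrite H1.
  lra.
have [f0|f0] := eqVneq (flat_comp X i 0 x) 0; have [f1|f1] := eqVneq (flat_comp X i 1 x) 0.
- by move: X0; rewrite (flat_comp_eq0 Ax f0 f1) eqxx.
- have E11 := E 1 1; have E01 := E 0 1; move: E11 E01; rewrite f0 mulr0 addr0.
  move=> E11 /eqP; rewrite mulf_eq0 (negbTE f1) orbF => /eqP p0.
  have /eqP : partial 1 (gauss_curvature i) x * flat_comp X i 1 x = 0 by lra.
  rewrite mulf_eq0 (negbTE f1) orbF => /eqP p1.
  by move: a; apply: ord2_ind.
- have E00 := E 0 0; have E01 := E 0 1; move: E00 E01; rewrite f1 mulr0 add0r.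
  move=> E00 /eqP; rewrite mulf_eq0 (negbTE f0) orbF => /eqP p1.
  have /eqP : partial 0 (gauss_curvature i) x * flat_comp X i 0 x = 0 by lra.
  rewrite mulf_eq0 (negbTE f0) orbF => /eqP p0.
  by move: a; apply: ord2_ind.
- have /eqP : partial 0 (gauss_curvature i) x * flat_comp X i 0 x = 0 by have := E 0 0; lra.
  rewrite mulf_eq0 (negbTE f0) orbF => /eqP p0.
  have /eqP : partial 1 (gauss_curvature i) x * flat_comp X i 1 x = 0 by have := E 1 1; lra.
  rewrite mulf_eq0 (negbTE f1) orbF => /eqP p1.
  by move: a; apply: ord2_ind.
Qed.

End LocalKilling.

(** * Unique continuation *)

Section Estimates.
Context {R : realType}.
Implicit Types (m u v w : R).

Lemma norm_lin3_le m (a b c : R) u v w : `|a| <= m -> `|b| <= m -> `|c| <= m ->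
  `|a * u + b * v + c * w| <= m * (`|u| + `|v| + `|w|).
Proof.
move=> am bm cm; rewrite !mulrDr.
apply: (le_trans (ler_normD _ _)); apply: lerD; last by rewrite normrM ler_wpM2r.
by apply: (le_trans (ler_normD _ _)); apply: lerD; rewrite normrM ler_wpM2r.
Qed.

Lemma norm_mul_le (m S u du : R) : `|u| <= S -> `|du| <= m * S ->
  `|du * u + u * du| <= 2 * m * (S * S).
Proof.
move=> uS dS; rewrite (_ : du * u + u * du = 2 * (u * du)); last by ring.
rewrite normrM (ger0_norm (_ : 0 <= 2)) // -mulrA ler_wpM2l //.
by rewrite normrM mulrCA; apply: ler_pM.
Qed.

(** With S the sum of absolute values, the three terms are at most 2 m S^2, 2 m S^2 and 8 m S^2, and
    S^2 is at most 3 times the sum of squares; hence 36 = 3 (2 + 2 + 8). *)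
Lemma norm_energy_le m u v w (du dv dw : R) : 0 <= m ->
  `|du| <= m * (`|u| + `|v| + `|w|) -> `|dv| <= m * (`|u| + `|v| + `|w|) ->
  `|dw| <= 4 * m * (`|u| + `|v| + `|w|) ->
  `|(du * u + u * du + (dv * v + v * dv)) + (dw * w + w * dw)| <=
    36 * m * (u * u + v * v + w * w).
Proof.
move=> m0; set S := `|u| + `|v| + `|w| => hu hv hw.
have [un vn wn] : [/\ 0 <= `|u|, 0 <= `|v| & 0 <= `|w|] by split.
have Su := norm_mul_le (S := S) (u := u) _ hu.
have Sv := norm_mul_le (S := S) (u := v) _ hv.
have Sw := norm_mul_le (S := S) (u := w) _ hw.
have S2 : S * S <= 3 * (u * u + v * v + w * w).
  rewrite -!expr2 -(real_normK (num_real u)) -(real_normK (num_real v)).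
  rewrite -(real_normK (num_real w)) /S.
  move: `|u| `|v| `|w| => p q r.
  have := sqr_ge0 (p - q); have := sqr_ge0 (p - r); have := sqr_ge0 (q - r); rewrite !expr2; lra.
apply: (@le_trans _ _ (12 * m * (S * S))); last first.
  rewrite (_ : 36 * m * _ = 12 * m * (3 * (u * u + v * v + w * w))); last by ring.
  by rewrite ler_wpM2l // mulr_ge0.
have {}Su : `|du * u + u * du| <= 2 * m * (S * S) by apply: Su; rewrite /S; lra.
have {}Sv : `|dv * v + v * dv| <= 2 * m * (S * S) by apply: Sv; rewrite /S; lra.
have {}Sw : `|dw * w + w * dw| <= 2 * (4 * m) * (S * S) by apply: Sw; rewrite /S; lra.
apply: (le_trans (ler_normD _ _)).
have := ler_normD (du * u + u * du) (dv * v + v * dv).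
move: Su Sv Sw; move: (S * S) `|_ + _| `|_ + _| `|_ + _| `|_ + _ + _| => *; lra.
Qed.

Lemma le_sum2 (F : 'I_2 -> R) a : (forall b, 0 <= F b) -> F a <= \sum_(b < 2) F b.
Proof.
by move=> F0; rewrite sum2; move: a; apply: ord2_ind; rewrite ?lerDl ?lerDr.
Qed.

(** Allows local bounds to be read off from sums of squares, which are smooth where absolute values
    are not. *)
Lemma norm_le_sqr (t : R) : `|t| <= 1 + t ^+ 2.
Proof.
have := sqr_ge0 (`|t| - 1); rewrite -(real_normK (num_real t)).
have := normr_ge0 t; move: `|t| => s s0; rewrite !expr2; lra.
Qed.

End Estimates.

Section UniqueContinuation.
Context {R : realType} (M : riemannian_surface R) (i : chart M).
Implicit Types (x : R * R) (a b c d : 'I_2) (X LX : vector_field M).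

Local Notation A := (chart_image i).
Local Notation Gam := (christoffel i).
Local Notation hA := (chart_image_half_open i).

Lemma christoffel_riemann_bound x0 : A x0 -> exists m V, [/\ open V, V x0, 1 <= m &
  forall y, A y -> V y -> (forall a b c, `|Gam a b c y| <= m) /\
                          (forall b c, `|riemann i y 0 1 b c| <= m)].
Proof.
move=> Ax.
pose H1 y := \sum_(a < 2) \sum_(b < 2) \sum_(c < 2) Gam a b c y ^+ 2.
pose H2 y := \sum_(b < 2) \sum_(c < 2) riemann i y 0 1 b c ^+ 2.
have s1 : smooth_on A H1.
  apply: smooth_on_sum => a; apply: smooth_on_sum => b; apply: smooth_on_sum => c.
  by apply: smooth_onM; exact: smooth_christoffel.
have s2 : smooth_on A H2.
  apply: smooth_on_sum => b; apply: smooth_on_sum => c.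
  by apply: smooth_onM; exact: smooth_riemann.
have h1 y : 0 <= H1 y by do 3 apply: sumr_ge0 => ? _; exact: sqr_ge0.
have h2 y : 0 <= H2 y by do 2 apply: sumr_ge0 => ? _; exact: sqr_ge0.
(* One unit for the passage from squares to absolute values, one for the variation of H1 + H2 near
   x0. *)
pose m := 2 + (H1 x0 + H2 x0).
have hlt : H1 x0 + H2 x0 < 1 + (H1 x0 + H2 x0) by rewrite ltrDr.
have [V [oV Vx HV]] := smooth_on_near (smooth_onD s1 s2) Ax (P := [set z | z < 1 + (H1 x0 + H2 x0)])
  (@open_lt _ _) hlt.
exists m, V; split=> //.
  by have := h1 x0; have := h2 x0; rewrite /m; move: (H1 x0) (H2 x0) => *; lra.
move=> y Ay Vy; have := HV y Ay Vy; rewrite /= => Hy; split.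
  move=> a b c; apply: (le_trans (norm_le_sqr _)).
  have : Gam a b c y ^+ 2 <= H1 y.
    apply: (le_trans (le_sum2 (F := fun c => Gam a b c y ^+ 2) c (fun=> sqr_ge0 _))).
    apply: (le_trans (le_sum2 (F := fun b => \sum_(c < 2) Gam a b c y ^+ 2) b _)).
      by move=> ?; apply: sumr_ge0 => ? _; exact: sqr_ge0.
    apply: (le_sum2 (F := fun a => \sum_(b < 2) \sum_(c < 2) Gam a b c y ^+ 2) a).
    by move=> ?; do 2 apply: sumr_ge0 => ? _; exact: sqr_ge0.
  by have := h2 y; move: Hy; rewrite /m; move: (H1 y) (H2 y) (H1 x0) (H2 x0) (_ ^+ 2) => *; lra.
move=> b c; apply: (le_trans (norm_le_sqr _)).
have : riemann i y 0 1 b c ^+ 2 <= H2 y.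
  apply: (le_trans (le_sum2 (F := fun c => riemann i y 0 1 b c ^+ 2) c (fun=> sqr_ge0 _))).
  apply: (le_sum2 (F := fun b => \sum_(c < 2) riemann i y 0 1 b c ^+ 2) b).
  by move=> ?; apply: sumr_ge0 => ? _; exact: sqr_ge0.
by have := h1 y; move: Hy; rewrite /m; move: (H1 y) (H2 y) (H1 x0) (H2 x0) (_ ^+ 2) => *; lra.
Qed.

(** B is chosen before q and U: an open set of zeros meeting B, however small, spreads over all of
    B. This uniformity makes the interior of the zero set closed. *)
Lemma killing_unique_continuation X x0 : killing X -> A x0 ->
  exists B, [/\ open B, B x0 & forall q U, A q -> B q -> open U -> U q ->
    (forall y, A y -> U y -> X i y = 0) -> forall y, A y -> B y -> X i y = 0].
Proof.
move=> kX Ax0.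
have [m [V [oV Vx m1 mV]]] := christoffel_riemann_bound Ax0.
have [u1 [v1 [u2 [v2 [rx rV rA]]]]] := half_open_rect hA Ax0 oV Vx.
have oB := @rect_open R u1 v1 u2 v2.
exists (rect u1 v1 u2 v2); split=> // q U Aq rq oU Uq X0.
(* The Gronwall estimate must start off the boundary line, where q itself may lie. *)
have [q' [[Uq' rq'] Aq' q'0]] := half_open_dense hA Aq (openI oU oB) (conj Uq rq).
have m0 : 0 <= m by apply: le_trans m1.
have sF := @smooth_flat_comp R M i X; have sc := @smooth_curl R M i X.
pose N y := flat_comp X i 0 y * flat_comp X i 0 y + flat_comp X i 1 y * flat_comp X i 1 y
  + curl X i y * curl X i y.
have sN : smooth_on A N by apply: smooth_onD; [apply: smooth_onD|]; exact: smooth_onM.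
have f0 b y : A y -> U y -> flat_comp X i b y = 0.
  by move=> Ay Uy; rewrite flat_compE X0 // !mxE !mul0r addr0.
have Nq : N q' = 0.
  rewrite /N !f0 // !mul0r !add0r.
  (* Here X must vanish near q' and not only at it: a rotation about q' vanishes there with nonzero
     curl. *)
  have -> : curl X i q' = 0.
    rewrite /curl /curl_comp.
    rewrite (@partial_ext _ _ U _ (fun=> 0) q' 0 hA Aq' oU Uq'); last first.
      by move=> y [Ay Uy]; rewrite -[RHS]/(flat_comp X i 1 y) f0.
    rewrite (@partial_ext _ _ U _ (fun=> 0) q' 1 hA Aq' oU Uq'); last first.
      by move=> y [Ay Uy]; rewrite -[RHS]/(flat_comp X i 0 y) f0.
    by rewrite !partial_cst subr0.
  by rewrite mul0r.
have N0 : forall y, A y -> rect u1 v1 u2 v2 y -> N y = 0.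
  apply: (@half_open_gronwall _ A N (36 * m) u1 v1 u2 v2 q' hA sN rA) => //.
    by move=> y _; rewrite /N -!expr2 !addr_ge0 ?sqr_ge0.
  move=> a y Ay ry; have [Gm Rm] := mV y Ay (rV _ ry).
  rewrite (partialD a hA) //; try by [exact: smooth_onM|apply: smooth_onD; exact: smooth_onM].
  rewrite (partialD a hA) //; try exact: smooth_onM.
  rewrite !(partialM a hA) //.
  have sg b : `|area_sign (R := R) a b / 2| <= m.
    apply: le_trans m1; rewrite /area_sign; case: (a == b); first by rewrite mul0r normr0.
    by case: (a == 0); rewrite ler_norml; lra.
  apply: norm_energy_le => //.
  - by rewrite (killing_partial_flat _ _ kX Ay); apply: norm_lin3_le.
  - by rewrite (killing_partial_flat _ _ kX Ay); apply: norm_lin3_le.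
  rewrite (partial_curl _ kX Ay).
  have := Gm a 0 0; have := Gm a 1 1; have := Rm a 0; have := Rm a 1.
  move: (flat_comp X i 0 y) (flat_comp X i 1 y) (curl X i y).
  move: (Gam a 0 0 y) (Gam a 1 1 y) (riemann i y 0 1 a 0) (riemann i y 0 1 a 1).
  move=> G0 G1 R0 R1 u v w hR1 hR0 hG1 hG0.
  rewrite (_ : _ + _ = (2 * R0) * u + (2 * R1) * v + (G0 + G1) * w); last by ring.
  (* The coefficients in [partial_curl] are at most 2 m; the factor 4 expected by [norm_energy_le]
     leaves room. *)
  apply: le_trans (_ : 2 * m * (`|u| + `|v| + `|w|) <= _).
    apply: norm_lin3_le.
    + by rewrite normrM (ger0_norm (_ : 0 <= 2)) // ler_wpM2l.
    + by rewrite normrM (ger0_norm (_ : 0 <= 2)) // ler_wpM2l.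
    + by apply: (le_trans (ler_normD _ _)); lra.
  by rewrite ler_wpM2r ?addr_ge0 // ler_wpM2r // ler_nat.
move=> y Ay ry; have := N0 y Ay ry; rewrite /N -!expr2 => /eqP.
rewrite paddr_eq0 ?addr_ge0 ?sqr_ge0 // paddr_eq0 ?sqr_ge0 // !sqrf_eq0.
by move=> /andP[/andP[/eqP h0 /eqP h1] _]; exact: flat_comp_eq0.
Qed.

End UniqueContinuation.

(** * Globalization *)

Section Charts.
Context {R : realType} (M : surface R).
Implicit Types (i j : chart M) (p q : M) (N : set M) (B : set (R * R)).

Lemma chart_image_map i p : chart_dom i p -> chart_image i (chart_map i p).
Proof. by move=> dp; exists p. Qed.

Lemma chart_preimage_open i B : open B ->
  open [set p : M | chart_dom i p /\ B (chart_map i p)].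
Proof.
move=> oB; rewrite openE => p [dp Bp].
have := chart_map_continuous (i := i).
rewrite continuous_open_subspace; last exact: chart_dom_open.
move=> /(_ p (mem_set dp)) cp.
have nB : nbhs p (chart_map i @^-1` B) by apply: cp; exact: open_nbhs_nbhs.
have nd : nbhs p (chart_dom i) by apply: open_nbhs_nbhs; split=> //; exact: chart_dom_open.
exact: filterI nd nB.
Qed.

(** The inverse chart is continuous only relative to the chart image, so near [chart_map i p] the
    set N is controlled by the trace of a planar open set on that image. *)
Lemma chart_image_open_nbhs i N p : open N -> N p -> chart_dom i p ->
  exists U : set (R * R), [/\ open U, U (chart_map i p) &
    forall y, chart_image i y -> U y ->
      exists q : M, [/\ N q, chart_dom i q & chart_map i q = y]].
Proof.
move=> oN Np dp.
have ci := chart_inv_continuous (i := i).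
have Ip := chart_image_map dp.
have nN : nbhs (chart_inv i (chart_map i p)) N.
  by rewrite chart_mapK //; exact: open_nbhs_nbhs.
have /(nbhs_subspace_ex _ Ip)[V nV VN] : nbhs (chart_map i p : subspace (chart_image i))
    (chart_inv i @^-1` N) by exact: ci nN.
have [U [oU Up UV]] := nbhs_open nV.
exists U; split=> // y Iy Uy; have [q dq qy] := Iy.
exists q; split=> //.
have : (V `&` chart_image i) y by split; [exact: UV|].
by rewrite -VN => -[/= + _]; rewrite -qy chart_mapK.
Qed.

Lemma vf_zero_transfer (X : vector_field M) i j p : chart_dom i p -> chart_dom j p ->
  X i (chart_map i p) = 0 -> X j (chart_map j p) = 0.
Proof.
move=> di dj X0.
have oij : overlap i j (chart_map i p) by exists p.
by have := vf_transform X oij; rewrite X0 mul0mx /transition chart_mapK.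
Qed.

End Charts.

Section Global.
Context {R : realType} (M : riemannian_surface R).
Hypothesis M_connected : connected [set: carrier M].
Implicit Types (i j : chart M) (p q : M) (X LX : vector_field M).

Lemma connected_clopen (Z : set M) : open Z -> open (~` Z) -> Z !=set0 -> Z = setT.
Proof.
move=> oZ oC Z0; apply: M_connected => //.
  by exists Z => //; rewrite setTI.
by exists Z; [rewrite -[Z]setCK; exact: open_closedC|rewrite setTI].
Qed.

Definition vf_zero X : set M :=
  [set p | forall i, chart_dom i p -> X i (chart_map i p) = 0].

(** The open and closed set is the interior of the zero set, not the zero set itself, since a
    nonzero Killing field may have isolated zeros. *)
Lemma killing_zero_interior X : killing X -> vf_nonzero X -> (vf_zero X)° = set0.
Proof.
move=> kX [i0 [x0 [p0 d0 px0] X0]].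
apply/eqP/negPn/negP => /set0P Zn0.
have oC : open (~` (vf_zero X)°).
  rewrite openE => p nZ.
  have [i di] := chart_dom_cover p.
  have [B [oB Bp BX]] := killing_unique_continuation kX (chart_image_map di).
  have oV := chart_preimage_open i oB.
  have nV : nbhs p [set p : M | chart_dom i p /\ B (chart_map i p)].
    by apply: open_nbhs_nbhs; split.
  apply: filterS nV => q [dq Bq] Zq; apply: nZ.
  have [U [oU Uq UZ]] := chart_image_open_nbhs (@open_interior _ (vf_zero X)) Zq dq.
  have X0B : forall y, chart_image i y -> B y -> X i y = 0.
    apply: (BX _ U (chart_image_map dq) Bq oU Uq) => y Iy Uy.
    have [r [Zr dr <-]] := UZ y Iy Uy.
    exact: (interior_subset Zr) dr.
  have nV : nbhs p [set p : M | chart_dom i p /\ B (chart_map i p)].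
    by apply: open_nbhs_nbhs; split.
  apply: filterS nV => r [dr Br] j dj.
  by apply: (vf_zero_transfer dr dj); apply: X0B => //; exact: chart_image_map.
have ZT := connected_clopen (open_interior _) oC Zn0.
have : (vf_zero X)° p0 by rewrite ZT.
by move=> /interior_subset /(_ i0 d0) E; move: X0; rewrite -px0 E eqxx.
Qed.

(** Otherwise all of N would consist of zeros, and p would be interior to the zero set. *)
Lemma killing_nonzero_dense X p N : killing X -> vf_nonzero X -> open N -> N p ->
  exists2 q, N q & forall i, chart_dom i q -> X i (chart_map i q) != 0.
Proof.
move=> kX nX oN Np; apply: contrapT => H.
suff : (vf_zero X)° p by rewrite (killing_zero_interior kX nX).
have nN : nbhs p N by exact: open_nbhs_nbhs.
apply: filterS nN => q Nq i di; apply/eqP/negPn/negP => X0.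
apply: H; exists q => // j dj; apply/eqP => Xj.
by move: X0; rewrite (vf_zero_transfer dj di Xj) eqxx.
Qed.

Variables X LX : vector_field M.
Hypotheses (X_nonzero : vf_nonzero X) (X_killing : killing X).
Hypotheses (LX_laplacian : is_hodge_laplacian X LX) (LX_killing : killing LX).

Lemma gauss_curvature_partial0 i a x : chart_image i x ->
  partial a (gauss_curvature i) x = 0.
Proof.
move=> Ax; apply/eqP/negPn/negP => dK.
have sdK : smooth_on (chart_image i) (partial a (gauss_curvature i)).
  by apply: smooth_on_partial; [exact: chart_image_half_open|exact: smooth_gauss_curvature].
have [U [oU Ux UK]] := smooth_on_near sdK Ax (P := [set z | z != 0]) (@open_neq _ _) dK.
have [p dp px] := Ax.
have Up : U (chart_map i p) by rewrite px.
have [q [dq Uq] Xq] := killing_nonzero_dense X_killing X_nonzero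
  (chart_preimage_open i oU) (conj dp Up).
have Iq := chart_image_map dq.
have := UK _ Iq Uq.
by rewrite /= (partial_gauss_curvature a X_killing LX_killing LX_laplacian Iq (Xq i dq)) eqxx.
Qed.

Lemma gauss_curvature_locally_constant i p : chart_dom i p ->
  exists N : set M, [/\ open N, N p & forall q, N q -> chart_dom i q /\
    gauss_curvature i (chart_map i q) = gauss_curvature i (chart_map i p)].
Proof.
move=> dp; have [B [oB Bp BK]] := half_open_constant (chart_image_half_open i)
  (@smooth_gauss_curvature R M i) (chart_image_map dp) (@gauss_curvature_partial0 i).
exists [set q : M | chart_dom i q /\ B (chart_map i q)]; split => //.
  exact: chart_preimage_open.
by move=> q [dq Bq]; split=> //; apply: BK => //; exact: chart_image_map.
Qed.

(** X may vanish at p, so the comparison is made at a nearby q with X nonzero, where both local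
    expressions of K still have their values at p. *)
Lemma gauss_curvature_transition i j p : chart_dom i p -> chart_dom j p ->
  gauss_curvature i (chart_map i p) = gauss_curvature j (chart_map j p).
Proof.
move=> di dj.
have [N [oN Np NK]] := gauss_curvature_locally_constant di.
have [N' [oN' Np' NK']] := gauss_curvature_locally_constant dj.
have [q [Nq Nq'] Xq] := killing_nonzero_dense X_killing X_nonzero (openI oN oN') (conj Np Np').
have [diq <-] := NK q Nq; have [djq <-] := NK' q Nq'.
have oij : overlap i j (chart_map i q) by exists q.
have XE := vf_transform X oij; have LE := vf_transform LX oij.
move: XE LE; rewrite /transition chart_mapK //.
rewrite (hodge_laplacian_killing X_killing LX_laplacian (chart_image_map diq)).
rewrite (hodge_laplacian_killing X_killing LX_laplacian (chart_image_map djq)).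
rewrite -scalemxAl => <- /eqP; rewrite -subr_eq0 -scalerBl scaler_eq0 (negbTE (Xq j djq)) orbF.
rewrite -mulrBr mulf_eq0 pnatr_eq0 /= subr_eq0 => /eqP ->.
by [].
Qed.

(** The chart is existentially quantified in Z, so Z is open by local constancy; openness of the
    complement also uses independence of the chart. *)
Lemma gauss_curvature_constant : exists kappa : R, forall i p, chart_dom i p ->
  gauss_curvature i (chart_map i p) = kappa.
Proof.
have [i0 [x0 [p0 d0 _] _]] := X_nonzero.
exists (gauss_curvature i0 (chart_map i0 p0)).
set k := gauss_curvature i0 _.
pose Z : set M := [set p | exists2 i, chart_dom i p & gauss_curvature i (chart_map i p) = k].
have loc p i : chart_dom i p -> \forall q \near p, chart_dom i q /\
    gauss_curvature i (chart_map i q) = gauss_curvature i (chart_map i p).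
  move=> di; have [N [oN Np NK]] := gauss_curvature_locally_constant di.
  by have : nbhs p N by [exact: open_nbhs_nbhs]; apply: filterS.
have oZ : open Z.
  rewrite openE => p [i di Kp]; apply: filterS (loc p i di) => q [dq Kq].
  by exists i => //; rewrite Kq.
have oC : open (~` Z).
  rewrite openE => p nZ; have [i di] := chart_dom_cover p.
  apply: filterS (loc p i di) => q [dq Kq] [j dj Kj]; apply: nZ.
  by exists i => //; rewrite -Kq (gauss_curvature_transition dq dj).
have ZT : Z = setT by apply: connected_clopen => //; exists p0, i0.
move=> i p di; have [j dj <-] : Z p by rewrite ZT.
exact: gauss_curvature_transition.
Qed.

End Global.

(** The zero field is Killing with zero Laplacian on any surface, and a component on which X
    vanishes would be unconstrained; hence the nonzero field and the connected surface. *)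
Theorem theorem3p1 (R : realType) (M : riemannian_surface R)
    (M_connected : connected [set: carrier M]) (X LX : vector_field M)
    (X_nonzero : vf_nonzero X) (X_killing : killing X)
    (LX_laplacian : is_hodge_laplacian X LX) (LX_killing : killing LX) :
  constant_sectional_curvature M.
Proof.
have [kappa K] := gauss_curvature_constant M_connected X_nonzero X_killing LX_laplacian LX_killing.
exists kappa => i x Ax u v free.
by rewrite sectional_curvatureE //; have [p dp <-] := Ax; exact: K.
Qed.
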